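(* If $G$ is a graph, then $\inf h(\mathcal{P}_G)\ge \dfrac{1}{\Lambda(G)}\cdot\log 3$.
   Context: A (topological) graph is a compact connected metric space homeomorphic to the geometric carrier of a one-dimensional simplicial complex. A subgraph of $G$ is a subset of $G$ that is itself a graph, equivalently a nondegenerate subcontinuum of $G$. All maps are continuous. A map $f\colon G\to G$ is mixing if for any nonempty open $U,V\subset G$ there is $N>0$ with $f^n(U)\cap V\neq\emptyset$ for all $n\ge N$; it is exact if for every nonempty open $U\subset G$ there is $n\ge 0$ with $f^n(U)=G$; it is pure mixing if it is mixing but not exact. $h(f)\in[0,+\infty]$ denotes topological entropy. $\mathcal{P}_G$ is the family of all pure mixing maps $f\colon G\to G$ and $\inf h(\mathcal{P}_G)=\inf\{h(f): f\in\mathcal{P}_G\}$. The disconnecting number $D^s(G)$ of a graph $G$ is the least $n>0$ such that for every subset $D\subset G$ of cardinality $n$ the set $G\setminus D$ is not connected. $\Lambda(G)$ denotes the maximal disconnecting number among all subgraphs of $G$. *)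

(* Defs.v *)
From mathcomp Require Import all_boot all_order all_algebra.
From mathcomp Require Import all_classical all_reals all_analysis.

Set Implicit Arguments.
Unset Strict Implicit.
Unset Printing Implicit Defensive.

Import Order.TTheory GRing.Theory Num.Theory.
Import numFieldNormedType.Exports.

Local Open Scope classical_set_scope.
Local Open Scope ring_scope.

(* Finite complexes are enough: a compact carrier meets only finitely many
   simplices. *)
Definition simplicial_complex n (K : {set {set 'I_n}}) : Prop :=
  finset.set0 \notin K /\
  forall s t : {set 'I_n},
    s \in K -> t \subset s -> t != finset.set0 -> t \in K.

Definition complex_dim n (K : {set {set 'I_n}}) : nat :=
  (\max_(s in K) #|s|.-1)%N.

(* The standard geometric realization: the vertices are the unit vectors of R^n
   and a point is given by its barycentric coordinates. *)
Definition carrier (R : realType) n (K : {set {set 'I_n}}) : set 'rV[R]_n :=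
  [set x : 'rV[R]_n | [/\ forall i, 0 <= x 0 i, \sum_i x 0 i = 1
             & [set i | x 0 i != 0]%SET \in K]].

Definition homeomorphic (T U : topologicalType) (A : set T) (B : set U) : Prop :=
  exists (f : T -> U) (g : U -> T),
    [/\ {within A, continuous f}, {within B, continuous g},
        f @` A `<=` B, g @` B `<=` A
      & (forall x, A x -> g (f x) = x) /\ (forall y, B y -> f (g y) = y)].

(* A subset [A] of a metric space is a graph in the subspace topology; the space
   [T] itself is a graph when [is_graph [set: T]] holds. *)
Definition is_graph (R : realType) (T : metricType R) (A : set T) : Prop :=
  [/\ compact A, connected A &
      exists n (K : {set {set 'I_n}}),
        [/\ simplicial_complex K, complex_dim K = 1%N
          & homeomorphic A (@carrier R n K)]].

Definition disconnecting (T : topologicalType) (A : set T) : set nat :=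
  [set n | (0 < n)%N /\
    forall D : set T, D `<=` A -> (D #= `I_n)%card -> ~ connected (A `\` D)].

(* D^s(A), the least element of [disconnecting A]. The default 0 is only used
   when that set is empty, which is never the case for a graph. *)
Definition disconnecting_number (T : topologicalType) (A : set T) : nat :=
  xget 0%N (disconnecting A `&` lbound (disconnecting A)).

(* The maximum exists when [T] is a graph; the default 0 is not used there. *)
Definition Lambda (R : realType) (T : metricType R) : nat :=
  let S := [set disconnecting_number A | A in @is_graph R T] in
  xget 0%N (S `&` ubound S).

Definition mixing (T : topologicalType) (f : T -> T) : Prop :=
  forall U V : set T, open U -> open V -> U !=set0 -> V !=set0 ->
    exists2 N, (0 < N)%N &
      forall n, (N <= n)%N -> (iter n f @` U) `&` V !=set0.

Definition exact_map (T : topologicalType) (f : T -> T) : Prop :=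
  forall U : set T, open U -> U !=set0 -> exists n, iter n f @` U = setT.

Definition pure_mixing_maps (T : topologicalType) : set (T -> T) :=
  [set f | [/\ continuous f, mixing f & ~ exact_map f]].

Definition separated_seq (R : realType) (T : metricType R) (f : T -> T)
    (n : nat) (eps : R) (s : seq T) : Prop :=
  uniq s /\
  forall x y, x \in s -> y \in s -> x != y ->
    exists2 k, (k < n)%N & eps < mdist (iter k f x) (iter k f y).

Definition separation_number (R : realType) (T : metricType R) (f : T -> T)
    (n : nat) (eps : R) : \bar R :=
  ereal_sup [set (size s)%:R%:E | s in separated_seq f n eps].

(* Bowen's definition, with natural logarithms; the limit as eps tends to 0 is
   a supremum because the inner limit is nonincreasing in eps. *)
Definition topological_entropy (R : realType) (T : metricType R) (f : T -> T) :
    \bar R :=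
  ereal_sup
    [set limn_esup (fun n => (n%:R^-1)%:E * lne (separation_number f n eps))%E
    | eps in [set eps : R | 0 < eps]].

(* Main.v *)
(* A graph is handled as a finite family of arcs glued at their ends. A map f that is
   mixing but not exact has an arc J inside an open set witnessing non-exactness with
   J contained in f^n(J) for all large n; a finite union of images of J gives
   subcontinua D_0, D_1 = f(D_0), ... that increase, are never the whole graph, and
   meet every open set eventually. After subdividing, D_n misses of each arc at most
   an initial piece, shrinking to the start of the arc ("end" of the exhaustion).
   Every end has a preimage end, and an end is mapped into a single end, so f permutes
   the ends: some end is fixed by f^k, with k at most the number of ends. Near it f^k is
   an interval map fixing 0 that, by mixing, has points jumping over every small level
   in both directions, while the preimages of 0 stay near 0; this forces a
   3-horseshoe, whence h(f) >= log 3 / k. Finally, for large n, D_n is a subgraph in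
   which every end gives a vertex of degree one. Removing such vertices does not
   disconnect D_n, so its disconnecting number exceeds the number of ends. *)
Require Import Defs.
From mathcomp Require Import all_boot all_order all_algebra.
From mathcomp Require Import all_classical all_reals all_analysis.
From mathcomp Require Import ring lra zify.

Set Implicit Arguments.
Unset Strict Implicit.
Unset Printing Implicit Defensive.

Import Order.TTheory GRing.Theory Num.Theory.
Import numFieldNormedType.Exports.

Local Open Scope classical_set_scope.
Local Open Scope ring_scope.

(** * Families of arcs *)

(** That [D n.+1] is the image of [D n] is what turns missing points into dynamics: a preimage of a
    point outside [D n.+1] lies outside [D n], hence near an end, while images of compact pieces of
    [D n] stay in [D n.+1] and so keep away from the starts of the ends. A graph carries no order;
    intermediate values are replaced by one principle, [arc_separation]: a connected set that
    contains a point of an open subarc and avoids both of its end points lies inside it, so it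
    cannot visit any other arc. This is why a second arc is always kept at hand. The maximum runs
    over subgraphs because ends belong to the exhaustion and not to [G]: on a circle, arcs that grow
    towards a single missing point have two ends, and only the growing arc, as a subgraph, accounts
    for them. The 3 comes from jumps in both directions at every small level: between two fixed
    points they place a high point before a low one, and the three laps so bounded each cover the
    whole span. *)

Lemma connected_closed_split (T : topologicalType) (C A B : set T) :
  connected C -> closed A -> closed B -> C `<=` A `|` B ->
  C `&` A `&` B = set0 -> C `<=` A \/ C `<=` B.
Proof.
move=> cC cA cB CAB ABC; have [[x [Cx Ax]]|noA] := pselect (C `&` A !=set0).
- left; suff -> : C = C `&` A by apply: subIsetr.
  apply/esym/cC; [by exists x| |by exists A].
  exists (~` B); first exact: closed_openC.
  apply/seteqP; split => y [Cy ABy]; split => //.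
  + by move=> By; rewrite -[False]/(set0 y) -ABC.
  + by have [] := CAB _ Cy.
- by right=> y Cy; have [Ay|//] := CAB _ Cy; case: noA; exists y.
Qed.

(** A finite remainder is closed, so it would split [A]. This discards finitely many exceptional
    points, such as isolated vertices of a complex or stray starts of arcs, and shows that a subarc
    is infinite. *)
Lemma connected_cofinite (T : topologicalType) (A P : set T) :
  hausdorff_space T -> connected A -> closed P -> P `<=` A -> P !=set0 ->
  finite_set (A `\` P) -> A = P.
Proof.
move=> hT cA cP PA [x Px] fAP; apply/seteqP; split => //.
have [|||AP] := connected_closed_split cA cP
  (accessible_finite_set_closed.1 (hausdorff_accessible hT) _ fAP).
- by move=> y Ay; have [Py|Py] := pselect (P y); [left|right].
- by apply/seteqP; split => // y [[Ay Py] []].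
- by [].
- by have [_ /(_ Px)] := AP x (PA _ Px).
Qed.

Section paths.
Context {R : realType} {T : topologicalType}.
Implicit Types (g : R -> T) (a b : R).

Lemma path_compact g a b : continuous g -> compact (g @` `[a, b]).
Proof.
move=> cg; apply: continuous_compact; last exact: segment_compact.
exact: continuous_subspaceT.
Qed.

Lemma path_closed g a b : hausdorff_space T -> continuous g ->
  closed (g @` `[a, b]).
Proof. by move=> hT cg; apply: compact_closed => //; exact: path_compact. Qed.

Lemma path_connected g a b : continuous g -> connected (g @` `[a, b]).
Proof.
move=> cg; apply: connected_continuous_connected; first exact: segment_connected.
exact: continuous_subspaceT.
Qed.

End paths.

(* The paths are defined on the whole line only to keep continuity global: their
   values outside [0, 1] are irrelevant. *)
Record arcs (R : realType) (G : metricType R) (A : set G) (E : finType)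
    (g : E -> R -> G) : Prop := Arcs {
  arc_cont : forall e, continuous (g e);
  arc_disj : forall e e' t t', 0 < t < 1 -> 0 <= t' <= 1 ->
    g e t = g e' t' -> e = e' /\ t = t';
  arc_ends : forall e, g e 0 <> g e 1;
  arc_cover : A = \bigcup_(e in [set: E]) g e @` `[0, 1] }.

Arguments arc_cont {R G A E g} Ag e x : rename.
Arguments arc_ends {R G A E g} Ag e : rename.

Section arcs_theory.
Context {R : realType} {G : metricType R} {A : set G} {E : finType}.
Context {g : E -> R -> G} (Ag : arcs A g).
Implicit Types (a b t : R) (e : E) (C : set G).

Lemma arc_inj e t t' : 0 <= t <= 1 -> 0 <= t' <= 1 -> g e t = g e t' -> t = t'.
Proof.
move=> t01 t'01 gtt'.
have [tin|tout] := boolP (0 < t < 1); first by have [] := arc_disj Ag tin t'01 gtt'.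
have [t'in|t'out] := boolP (0 < t' < 1).
  by have [] := arc_disj Ag t'in t01 (esym gtt').
have E01 (s : R) : 0 <= s <= 1 -> ~~ (0 < s < 1) -> s = 0 \/ s = 1.
  case/andP; rewrite le_eqVlt => /orP[/eqP<-|s0]; first by left.
  by rewrite le_eqVlt => /orP[/eqP->|s1]; [right|rewrite s0 s1].
have := arc_ends Ag e; move: gtt'.
by case: (E01 _ t01 tout) => ->; case: (E01 _ t'01 t'out) => -> // /esym.
Qed.

Lemma arc_closed e a b : closed (g e @` `[a, b]).
Proof. exact: path_closed (@metric_hausdorff R G) (arc_cont Ag e). Qed.

Lemma arc_sub e t : 0 <= t <= 1 -> A (g e t).
Proof. by move=> t01; rewrite (arc_cover Ag); exists e => //; exists t => //=; rewrite in_itv. Qed.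

Lemma arc_coverP x : A x -> exists e t, 0 <= t <= 1 /\ x = g e t.
Proof.
rewrite (arc_cover Ag) => -[e _ [t]]; rewrite /= in_itv/= => t01 <-.
by exists e, t.
Qed.

(** A closed set, as a finite union of compact paths. For [0 <= a] and [b <= 1] it is what the open
    subarc of [e] between [a] and [b] leaves of [A]. *)
Definition arc_outside e a b : set G :=
  (\bigcup_(e' in [set e' | e' != e]) g e' @` `[0, 1]) `|`
  (g e @` `[0, a] `|` g e @` `[b, 1]).

Lemma arc_outside_closed e a b : closed (arc_outside e a b).
Proof.
apply: closedU; last by apply: closedU; exact: arc_closed.
apply: closed_bigcup; first exact: finite_finset.
by move=> e' _; exact: arc_closed.
Qed.

Lemma arc_outside_cover e a b :
  A `<=` g e @` `]a, b[ `|` arc_outside e a b.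
Proof.
move=> x /arc_coverP[e' [t [t01 ->]]].
have [->|e'e] := eqVneq e' e; last first.
  by right; left; exists e' => //; exists t => //=; rewrite in_itv.
have [ta|ta] := leP t a.
  right; right; left; exists t => //=; rewrite in_itv/= ta andbT.
  by case/andP: t01.
have [tb|tb] := leP b t.
  right; right; right; exists t => //=; rewrite in_itv/= tb.
  by case/andP: t01.
by left; exists t => //=; rewrite in_itv/= ta tb.
Qed.

Lemma arc_outsideF e a b t : 0 <= a -> b <= 1 -> a < t < b ->
  ~ arc_outside e a b (g e t).
Proof.
move=> a0 b1 /andP[ta tb].
have t01 : 0 < t < 1 by rewrite (le_lt_trans a0 ta) (lt_le_trans tb b1).
case=> [[e' /= e'e [s]]|[[s]|[s]]]; rewrite /= in_itv/= => /andP[s0 s1] /esym.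
- by move/(arc_disj Ag t01); rewrite s0 s1 => /(_ isT)[ee' _]; rewrite ee' eqxx in e'e.
- move/(arc_disj Ag t01); rewrite s0 (le_trans s1)//; last first.
    by rewrite ltW// (lt_trans ta)// (lt_le_trans tb).
  by move=> /(_ isT)[_ ts]; move: s1; rewrite -ts leNgt ta.
- move/(arc_disj Ag t01); rewrite s1 andbT (le_trans _ s0)//; last first.
    by rewrite ltW// (le_lt_trans a0)// (lt_trans ta).
  by move=> /(_ isT)[_ ts]; move: s0; rewrite -ts leNgt tb.
Qed.

(** The closed subarc and [arc_outside] are closed, cover [A] and overlap at most in [g e a] and
    [g e b], which [C] avoids. Connectedness puts [C] on one side, and [g e t] decides which. *)
Lemma arc_separation e a b t C : connected C -> C `<=` A ->
  0 <= a -> b <= 1 -> a < t < b -> C (g e t) ->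
  ~ C (g e a) -> ~ C (g e b) -> C `<=` g e @` `]a, b[.
Proof.
move=> cC CA a0 b1 atb Ct Ca Cb.
have inner x : C x -> (g e @` `[a, b]) x -> (g e @` `]a, b[) x.
  move=> Cx [s]; rewrite /= in_itv/= => /andP[as_ sb] gs; exists s => //=.
  rewrite in_itv/= !lt_neqAle as_ sb !andbT; apply/andP; split; apply/eqP.
    by move=> ?; subst s; apply: Ca; rewrite gs.
  by move=> ?; subst s; apply: Cb; rewrite gs.
have [||||H|H] := @connected_closed_split _ C (g e @` `[a, b]) (arc_outside e a b) cC.
- exact: arc_closed.
- exact: arc_outside_closed.
- move=> x /CA /(@arc_outside_cover e a b)[[s]|]; last by right.
  rewrite /= in_itv/= => /andP[as_ sb] <-; left; exists s => //=.
  by rewrite in_itv/= !ltW.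
- apply/seteqP; split => // x [[Cx /(inner _ Cx)[s]]]; rewrite /= in_itv/= => asb <-.
  exact: arc_outsideF.
- by move=> x Cx; apply: inner => //; apply: H.
- by have := arc_outsideF a0 b1 atb (H _ Ct).
Qed.

End arcs_theory.

Lemma arc_open (R : realType) (G : metricType R) (E : finType) (g : E -> R -> G)
    (e : E) (a b : R) : arcs setT g -> 0 <= a -> b <= 1 -> open (g e @` `]a, b[).
Proof.
move=> Gg a0 b1.
suff -> : g e @` `]a, b[ = ~` (arc_outside (g:=g) e a b).
  by apply: closed_openC; exact: (arc_outside_closed Gg).
apply/seteqP; split => [x [t]|x].
  by rewrite /= in_itv/= => atb <-; apply: (arc_outsideF Gg).
by move=> nx; case: (@arc_outside_cover _ _ _ _ _ Gg e a b x I).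
Qed.

(** * From simplicial complexes to arcs *)

Lemma continuous_comp_within (S T U : topologicalType) (B : set T) (c : S -> T)
    (k : T -> U) :
  continuous c -> (forall x, B (c x)) -> {within B, continuous k} ->
  continuous (k \o c).
Proof.
move=> cc Bc /continuousP ck; apply/continuousP => O oO.
have /open_subspaceP[V oV VB] := ck _ oO.
suff -> : (k \o c) @^-1` O = c @^-1` V by move/continuousP : cc; apply.
apply/seteqP; split => x /= Ox.
  by have [] : (V `&` B) (c x) by rewrite VB; split => //; exact: Bc.
by have [] : (k @^-1` O `&` B) (c x) by rewrite -VB; split => //; exact: Bc.
Qed.

(** For [a <= b], precomposition with it extends a path from [[a, b]] to the whole line, so that
    continuity can be stated globally. *)
Definition clamp (R : realType) (a b t : R) : R := Num.max a (Num.min b t).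

Lemma clamp_continuous (R : realType) (a b : R) : continuous (clamp a b).
Proof.
have cst (r : R) : continuous (fun _ : R => r) by move=> x; exact: cvg_cst.
apply: (max_fun_continuous (cst a)).
by apply: (min_fun_continuous (cst b)) => x; exact: cvg_id.
Qed.

Lemma clamp_itv (R : realType) (a b t : R) : a <= b -> a <= clamp a b t <= b.
Proof. by move=> ab; rewrite le_max lexx ge_max ab ge_min lexx. Qed.

Lemma clampK (R : realType) (a b t : R) : a <= t <= b -> clamp a b t = t.
Proof. by case/andP => at_ tb; rewrite /clamp min_r// max_r. Qed.

Lemma row_continuous (R : realType) (S : topologicalType) n (f : S -> 'rV[R]_n) :
  (forall j, continuous (fun x => f x 0 j)) -> continuous f.
Proof.
move=> cf x A [P nP PA].
have H : \forall y \near x, forall j, P 0 j (f y 0 j).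
  by apply: filter_forall => j; apply: cf; exact: nP.
by apply: filterS H => y Hy; apply: PA => i j; rewrite ord1.
Qed.

Section graph_arcs.
Context {R : realType} {n : nat}.
Implicit Types (p : 'I_n * 'I_n) (t : R).

(* Splitting every edge at its midpoint ensures that there are at least two arcs and
   that no two arcs share both ends. *)
Definition half_edge p t : 'rV[R]_n :=
  \row_l ((1 - clamp 0 1 t / 2) * (l == p.1)%:R + clamp 0 1 t / 2 * (l == p.2)%:R).

Lemma half_edge_continuous p : continuous (half_edge p).
Proof.
apply: row_continuous => j x; rewrite /half_edge.
under eq_fun do rewrite mxE.
have cx := @clamp_continuous R 0 1 x.
by apply: cvgD; apply: cvgMl; [apply: cvgB; [exact: cvg_cst|]|]; apply: cvgMl.
Qed.

Lemma half_edge_carrier (K : {set {set 'I_n}}) p t : simplicial_complex K ->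
  p.1 != p.2 -> [set p.1; p.2]%SET \in K -> @carrier R n K (half_edge p t).
Proof.
move=> [_ Ksub] p12 pK; have /andP[c0 c1] := clamp_itv t (@ler01 R).
have p21 : (p.2 == p.1) = false by apply/negbTE; rewrite eq_sym.
split=> [i||].
- by rewrite mxE addr_ge0// mulr_ge0// ?ler0n//; lra.
- under eq_bigr do rewrite mxE.
  rewrite big_split/= -!mulr_sumr.
  have S1 (j : 'I_n) : \sum_i ((i == j)%:R : R) = 1.
    by rewrite (bigD1 j)//= eqxx big1 ?addr0// => i /negbTE ->.
  by rewrite !S1; lra.
- apply: (Ksub _ _ pK).
    apply/fintype.subsetP => i; rewrite !inE mxE; apply: contraR.
    by rewrite negb_or => /andP[/negbTE -> /negbTE ->]; rewrite !mulr0 addr0.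
  apply/set0Pn; exists p.1; rewrite inE mxE eqxx (negbTE p12).
  by rewrite mulr0 addr0 mulr1; apply/eqP; lra.
Qed.

(** As [t < 1], only the coordinate at [p.1] exceeds 1/2; as [0 < t], the one at [p.2] is the only
    other nonzero one. So the point determines the ordered pair, and then the parameter. *)
Lemma half_edge_inj p q t s : p.1 != p.2 -> q.1 != q.2 ->
  0 < t < 1 -> 0 <= s <= 1 -> half_edge p t = half_edge q s -> p = q /\ t = s.
Proof.
move=> p12 q12 /andP[t0 t1] s01 /rowP E.
have cs := clampK s01; case/andP: s01 => s0 s1.
have ct : clamp 0 1 t = t by apply: clampK; rewrite !ltW.
have {}E l : (1 - t / 2) * (l == p.1)%:R + t / 2 * (l == p.2)%:R =
             (1 - s / 2) * (l == q.1)%:R + s / 2 * (l == q.2)%:R.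
  by have := E l; rewrite !mxE ct cs.
have p21 : (p.2 == p.1) = false by apply/negbTE; rewrite eq_sym.
have pq1 : p.1 = q.1.
  apply/eqP/contraT => /negbTE n1; have := E p.1.
  rewrite n1 eqxx (negbTE p12) /=.
  by case: (p.1 == q.2) => /= ?; lra.
have pq2 : p.2 = q.2.
  apply/eqP/contraT => /negbTE n2; have := E p.2.
  by rewrite n2 -pq1 p21 eqxx /= => ?; lra.
split; first by rewrite (surjective_pairing p) pq1 pq2 -surjective_pairing.
by have := E p.2; rewrite -pq1 -pq2 p21 eqxx /= => ?; lra.
Qed.

Lemma half_edge_ends p : p.1 != p.2 -> half_edge p 0 <> half_edge p 1.
Proof.
move=> p12 /rowP/(_ p.2); rewrite !mxE eqxx eq_sym (negbTE p12) !clampK ?lexx ?ler01//.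
by rewrite /= => ?; lra.
Qed.

Lemma half_edge_cover (K : {set {set 'I_n}}) (x : 'rV[R]_n) :
  complex_dim K = 1%N -> @carrier R n K x ->
  (exists i, x = delta_mx 0 i) \/
  exists p t, [/\ p.1 != p.2, [set p.1; p.2]%SET \in K, 0 <= t <= 1 &
    x = half_edge p t].
Proof.
move=> Kdim [x0 x1 xK].
have := @leq_bigmax_cond _ (mem K) (fun s => #|s|.-1) _ xK.
rewrite -[X in (_ <= X)%N]/(complex_dim K) Kdim.
set s := [set i | x 0 i != 0]%SET in xK * => s2.
have xs l : l \notin s -> x 0 l = 0 by rewrite inE negbK => /eqP.
have [s0|/card_gt0P s0] := leqP #|s| 0.
  have {}s0 : s = finset.set0 by apply/eqP; rewrite -cards_eq0 -leqn0.
  move: x1; rewrite big1 => [/eqP|i _]; first by rewrite eq_sym oner_eq0.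
  by apply: xs; rewrite s0 inE.
have [/cards1P[i si]|s1] := boolP (#|s| == 1%N).
  left; exists i.
  have xl l : l != i -> x 0 l = 0 by move=> li; apply: xs; rewrite si inE.
  apply/rowP => l; rewrite mxE/=; case: eqVneq => [->|/xl//].
  by move: x1; rewrite (bigD1 i)//= big1 ?addr0// => l' /xl.
right; have /cards2P[i [j [ij sij]]] : #|s| == 2%N.
  by move: s2 s1; case: #|s| (introT card_gt0P s0) => [|[|[|]]].
have xl l : l != i -> l != j -> x 0 l = 0.
  by move=> li lj; apply: xs; rewrite sij !inE negb_or li.
have xij : x 0 i + x 0 j = 1.
  move: x1; rewrite (bigD1 i)//= (bigD1 j)/=; last by rewrite eq_sym.
  by rewrite big1 ?addr0// => l /andP[]; exact: xl.
(* The half edge of an ordered pair carries the points with weight at most 1/2 on the second vertex,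
   so the heavier vertex comes first. *)
wlog xj : i j ij sij xl xij / x 0 j <= 1 / 2.
  move=> wl; have [xj|xj] := leP (x 0 j) (1 / 2); first exact: (wl i j).
  apply: (wl j i); [by rewrite eq_sym|by rewrite sij finset.setUC| |by rewrite addrC|lra].
  by move=> l lj li; exact: xl.
exists (i, j), (2 * x 0 j).
have t01 : 0 <= 2 * x 0 j <= 1 by have := x0 j; lra.
split => //=; first by rewrite -sij.
apply/rowP => l; rewrite mxE/= clampK//.
have [->|li] := eqVneq l i; first by rewrite (negbTE ij)/=; lra.
have [->|lj] := eqVneq l j; first by rewrite /=; lra.
by rewrite xl//= !mulr0 addr0.
Qed.

End graph_arcs.

Lemma is_graph_arcs (R : realType) (G : metricType R) : is_graph [set: G] ->
  exists (E : finType) (g : E -> R -> G),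
    [/\ arcs setT g, exists e : E, true & forall e : E, exists e', e' != e].
Proof.
move=> [_ conG [n [K [sK Kdim [h [k [_ ck hB _ [hk kh]]]]]]]].
pose EP (p : 'I_n * 'I_n) := (p.1 != p.2) && ([set p.1; p.2]%SET \in K).
pose E := {p | EP p}; pose g (e : E) := k \o half_edge (val e).
have car (e : E) t : @carrier R n K (half_edge (val e) t).
  by have /andP[? ?] := valP e; exact: half_edge_carrier.
have khI (e e' : E) t t' : g e t = g e' t' -> half_edge (val e) t = half_edge (val e') t'.
  by move=> /(congr1 h); rewrite /g /= (kh _ (car e t)) (kh _ (car e' t')).
have [e0 _] : exists e : E, true.
  have [s sK2 s2] : exists2 s, s \in K & #|s| == 2%N.
    apply: contrapT => noE.
    suff : (complex_dim K <= 0)%N by rewrite Kdim.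
    apply/bigmax_leqP => s sK1; rewrite -ltnS; case: (ltngtP #|s| 2%N) => [|s2|s2].
    - by case: #|s| => [|[|]].
    - have := @leq_bigmax_cond _ (mem K) (fun s => #|s|.-1) _ sK1.
      by rewrite -[X in (_ <= X)%N]/(complex_dim K) Kdim; move: s2; case: #|s| => [|[|[|]]].
    - by case: noE; exists s => //; exact/eqP.
  have /cards2P[i [j [ij sij]]] := s2.
  have ijE : EP (i, j) by rewrite /EP/= ij -sij.
  by exists (Sub (i, j) ijE).
exists E, g; split; last 2 first.
- by exists e0.
- move=> e; have /andP[e12 eK] := valP e.
  (* The other half of the same edge is the second arc. *)
  have eE : EP ((val e).2, (val e).1) by rewrite /EP/= eq_sym e12 finset.setUC.
  exists (Sub _ eE); apply/eqP => /(congr1 val); rewrite SubK => ee.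
  by move/eqP: e12; apply; rewrite -[in LHS]ee.
have cg e : continuous (g e).
  apply: continuous_comp_within ck; first exact: half_edge_continuous.
  exact: car.
split => //.
- move=> e e' t t' t01 t'01 /khI; have /andP[e12 _] := valP e.
  have /andP[e'12 _] := valP e'.
  by move/(half_edge_inj e12 e'12 t01 t'01) => [/val_inj].
- by move=> e /khI; have /andP[e12 _] := valP e; apply: half_edge_ends.
(* The half edges can only miss vertices that lie on no edge, and there are finitely many
   vertices. *)
apply: connected_cofinite => //.
- exact: metric_hausdorff.
- apply: closed_bigcup; first exact: finite_finset.
  by move=> e _; apply: path_closed => //; exact: metric_hausdorff.
- by exists (g e0 0); exists e0 => //; exists 0 => //=; rewrite in_itv/= lexx ler01.
apply: (@sub_finite_set _ _ (k @` range (fun i : 'I_n => delta_mx 0 i : 'rV[R]_n))).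
  move=> x [_ Px]; have hx : @carrier R n K (h x) by apply: hB; exists x.
  have [[i hi]|[p [t [p12 pK t01 hp]]]] := half_edge_cover Kdim hx.
    by exists (h x); [exists i|exact: hk].
  case: Px; have pE : EP p by rewrite /EP p12.
  exists (Sub p pE) => //; exists t; first by rewrite /= in_itv.
  by rewrite /g /= -hp hk.
by apply: finite_image; apply: finite_image; exact: finite_finset.
Qed.

(** * Exhaustion by images of an arc *)

Lemma iter_continuous (T : topologicalType) (f : T -> T) n :
  continuous f -> continuous (iter n f).
Proof.
move=> cf; elim: n => [|n IHn] x; first exact: cvg_id.
exact: (continuous_comp (IHn x) (cf _)).
Qed.

Lemma image_iterD (T : Type) (f : T -> T) m n (A : set T) :
  iter (m + n) f @` A = iter m f @` (iter n f @` A).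
Proof. by rewrite image_comp; apply: eq_imagel => x _ /=; rewrite iterD. Qed.

Lemma image_iterS (T : Type) (f : T -> T) n (A : set T) :
  f @` (iter n f @` A) = iter n.+1 f @` A.
Proof. by rewrite -(image_iterD f 1). Qed.

Lemma connected_image (S T : topologicalType) (f : S -> T) (A : set S) :
  continuous f -> connected A -> connected (f @` A).
Proof.
by move=> cf cA; apply: connected_continuous_connected => //;
  exact: continuous_subspaceT.
Qed.

Lemma compact_image (S T : topologicalType) (f : S -> T) (A : set S) :
  continuous f -> compact A -> compact (f @` A).
Proof.
by move=> cf cA; apply: continuous_compact => //; exact: continuous_subspaceT.
Qed.

Lemma arc_in_open (R : realType) (G : metricType R) (E : finType)
    (g : E -> R -> G) (U : set G) : arcs setT g -> open U -> U !=set0 ->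
  exists e a b, [/\ 0 <= a, a < b, b <= 1 & g e @` `[a, b] `<=` U].
Proof.
move=> Gg oU [x Ux]; have [e [t [/andP[t0 t1] xt]]] := arc_coverP Gg (I : setT x).
have : nbhs t (g e @^-1` U).
  by apply: (arc_cont Gg e t); rewrite -xt; exact: open_nbhs_nbhs.
move=> /nbhs_ballP[r /= r0 rU]; exists e.
have sub a b : t - r < a -> b < t + r -> g e @` `[a, b] `<=` U.
  move=> ar br y [s /=]; rewrite in_itv/= => /andP[as_ sb] <-; apply: rU.
  by rewrite /ball/= ltr_distlC; apply/andP; split; lra.
have [tlt|tge] := ltP t 1.
  exists t, (Num.min 1 (t + r / 2)); split => //.
  - by rewrite lt_min tlt; lra.
  - by rewrite ge_min lexx.
  - by apply: sub; [lra|rewrite gt_min; apply/orP; right; lra].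
exists (Num.max 0 (t - r / 2)), t; split => //.
- by rewrite le_max lexx.
- by rewrite gt_max; apply/andP; split; lra.
- by apply: sub; [rewrite lt_max; apply/orP; right; lra|lra].
Qed.

(* There are 16 pairs, and each of the three conditions excludes at most 4 of them. *)
Lemma two_step_loop (c1 c2 : rel 'I_4) :
  (forall i j l, ~~ c1 i j -> ~~ c1 i l -> j = l) ->
  (forall i j l, ~~ c2 i j -> ~~ c2 i l -> j = l) ->
  exists j x, [&& c1 j x, c1 x j & c2 x j].
Proof.
move=> m1 m2.
pose B (c : rel 'I_4) := [set p : 'I_4 * 'I_4 | ~~ c p.1 p.2]%SET.
pose B' (c : rel 'I_4) := [set p : 'I_4 * 'I_4 | ~~ c p.2 p.1]%SET.
have cB (c : rel 'I_4) : (forall i j l, ~~ c i j -> ~~ c i l -> j = l) ->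
    (#|B c| <= 4)%N /\ (#|B' c| <= 4)%N.
  move=> mc; split.
    rewrite -(@card_in_imset _ _ fst); first by rewrite -[X in (_ <= X)%N]card_ord max_card.
    move=> [i j] [i' j']; rewrite !inE/= => cij cij' ii'; subst i'.
    by rewrite (mc _ _ _ cij cij').
  rewrite -(@card_in_imset _ _ snd); first by rewrite -[X in (_ <= X)%N]card_ord max_card.
  move=> [i j] [i' j']; rewrite !inE/= => cij cij' ii'; subst j'.
  by rewrite (mc _ _ _ cij cij').
have [b1 b1'] := cB _ m1; have [_ b2'] := cB _ m2.
apply: contrapT => none.
have : (#|[set: 'I_4 * 'I_4]%SET| <= #|B c1 :|: B' c1 :|: B' c2|%SET)%N.
  apply/subset_leq_card/fintype.subsetP => -[j x] _; rewrite !inE/= -!negb_and.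
  by apply/negP => H; apply: none; exists j, x; rewrite -andbA in H.
rewrite cardsT card_prod !card_ord; apply/negP; rewrite -ltnNge.
apply: (@leq_ltn_trans (4 + 4 + 4)) => //.
apply: leq_trans (leq_card_setU _ _) _; apply: leq_add => //.
by apply: leq_trans (leq_card_setU _ _) _; exact: leq_add.
Qed.

(** The times at which [J] is covered are closed under addition, and every [n >= L * L] is a sum of
    copies of [L] and [L.+1]: as many of the latter as the remainder of [n] modulo [L]. *)
Lemma eventually_image_sup (T : Type) (f : T -> T) (J : set T) L : (0 < L)%N ->
  J `<=` iter L f @` J -> J `<=` iter L.+1 f @` J ->
  forall n, (L * L <= n)%N -> J `<=` iter n f @` J.
Proof.
move=> L0 JL JL1 n Ln.
have add m k : J `<=` iter m f @` J -> J `<=` iter k f @` J ->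
    J `<=` iter (m + k) f @` J.
  move=> Jm Jk; rewrite image_iterD; apply: subset_trans Jm _.
  exact: image_subset.
have mul k m : J `<=` iter m f @` J -> J `<=` iter (k * m) f @` J.
  by move=> Jm; elim: k => [|k IHk]; [rewrite mul0n image_id|rewrite mulSn; exact: add].
have rL := ltn_pmod n L0.
have qr : (n %% L <= n %/ L)%N.
  by rewrite (leq_trans (ltnW rL))// leq_divRL.
have -> : n = ((n %/ L - n %% L) * L + n %% L * L.+1)%N.
  by rewrite [LHS](divn_eq n L) mulnBl mulnS addnCA addnC subnK// leq_mul2r qr orbT.
by apply: add; apply: mul.
Qed.

Record exhaustion (T : topologicalType) (f : T -> T) (D : nat -> set T) : Prop :=
  Exhaustion {
    exh_closed : forall n, closed (D n);
    exh_connected : forall n, connected (D n);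
    exh_sub : forall n, D n `<=` D n.+1;
    exh_image : forall n, f @` D n = D n.+1;
    exh_neqT : forall n, D n <> setT;
    exh_dense : forall V, open V -> V !=set0 -> exists n, D n `&` V !=set0 }.

Arguments exh_closed {T f D} fD n : rename.
Arguments exh_connected {T f D} fD n : rename.
Arguments exh_sub {T f D} fD n : rename.

Section exhaustion_exists.
Context {R : realType} {G : metricType R} {E : finType} {g : E -> R -> G}.
Context (Gg : arcs setT g) (E2 : forall e : E, exists e', e' != e).
Context {f : G -> G} (cf : continuous f) (mf : mixing f).

Lemma arc_open_neq0 e a b : a < b -> g e @` `]a, b[ !=set0.
Proof.
move=> ab; exists (g e ((a + b) / 2)); exists ((a + b) / 2) => //=.
by rewrite in_itv/=; lra.
Qed.

(** At late times the image of each of four subarcs visits all gaps between them and another arc.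
    Being connected, it fails to cover at most one of the four. A single subarc might always fail to
    cover itself, hence the detour through a second one in [two_step_loop], which gives returns at
    two consecutive times. *)
Lemma self_covering_arc e a b : 0 <= a -> a < b -> b <= 1 ->
  exists c d, [/\ a <= c, c < d, d <= b &
    exists N, forall n, (N <= n)%N ->
      g e @` `[c, d] `<=` iter n f @` (g e @` `[c, d])].
Proof.
move=> a0 ab b1; have [e' e'e] := E2 e.
(* Eighths of [[a, b]]: four closed subarcs [[l i, r i]], each followed by a gap of the same
   length. *)
pose h : R := (b - a) / 8; have h0 : 0 < h by rewrite /h; lra.
pose l (i : nat) : R := a + (2 * i)%:R * h.
pose r (i : nat) : R := a + (2 * i).+1%:R * h.
have lr i : l i < r i by rewrite /l /r ltrD2l ltr_pM2r// ltr_nat.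
have rl i : r i < l i.+1 by rewrite /l /r ltrD2l ltr_pM2r// ltr_nat mulnS.
have al i : a <= l i by rewrite lerDl mulr_ge0// ?ler0n// ltW.
have bl (i : nat) : (i <= 4)%N -> l i <= b.
  move=> i4; have -> : b = a + 8%:R * h by rewrite /h; lra.
  by rewrite lerD2l ler_pM2r// ler_nat (@leq_mul2l 2 i 4).
have ll (i j : nat) : (i <= j)%N -> l i <= l j.
  by move=> ij; rewrite lerD2l ler_pM2r// ler_nat leq_mul2l.
pose J (i : 'I_4) := g e @` `[l i, r i].
have evt (i : 'I_4) (V : set G) : open V -> V !=set0 ->
    \forall m \near \oo, (iter m f @` J i) `&` V !=set0.
  move=> oV V0; have oU : open (g e @` `]l i, r i[).
    apply: (arc_open e Gg); first exact: le_trans (al _).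
    by rewrite (le_trans (ltW (rl _)))// (le_trans (bl _ _)).
  have [M _ HM] := mf oU oV (arc_open_neq0 _ (lr i)) V0.
  exists M => // m /= /HM[_ [[_ [t tJ <-] <-] Vt]].
  exists (iter m f (g e t)); split => //; exists (g e t) => //; exists t => //.
  by move: tJ; rewrite /= !in_itv/= => /andP[? ?]; rewrite !ltW.
have evgap (i j : 'I_4) : \forall m \near \oo,
    (iter m f @` J i) `&` (g e @` `]r j, l j.+1[) !=set0.
  apply: evt; last exact: arc_open_neq0.
  apply: (arc_open e Gg); first by rewrite (le_trans a0)// (le_trans (al j))// ltW.
  by rewrite (le_trans (bl _ _)).
have evgap' (i : 'I_4) : \forall m \near \oo, forall j : 'I_4,
    (iter m f @` J i) `&` (g e @` `]r j, l j.+1[) !=set0.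
  by apply: filter_forall => j; exact: evgap.
have eve' (i : 'I_4) : \forall m \near \oo,
    (iter m f @` J i) `&` (g e' @` `]0, 1[) !=set0.
  by apply: evt; [exact: (arc_open e' Gg)|exact: arc_open_neq0].
have [M _ HM] : \forall m \near \oo, forall i,
    (forall j : 'I_4, (iter m f @` J i) `&` (g e @` `]r j, l j.+1[) !=set0) /\
    (iter m f @` J i) `&` (g e' @` `]0, 1[) !=set0.
  apply: filter_forall => i.
  by apply: filterS2 (evgap' i) (eve' i) => m; split.
pose c m : rel 'I_4 := fun i j => `[< J j `<=` iter m f @` J i >].
have miss m i j k : (M <= m)%N -> ~~ c m i j -> ~~ c m i k -> j = k.
  move=> Mm; have [Hgap [z [Cz [w w01 wz]]]] := HM m Mm i.
  wlog jk : j k / (j < k)%N.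
    move=> H cj ck; case: (ltngtP j k) => [jk|kj|/val_inj//].
      exact: (H j k).
    by apply/esym/(H k j).
  move=> /asboolP/existsNP[p /not_implyP[[s]]] + ps Cs.
  move=> + /asboolP/existsNP[q /not_implyP[[t]]] + qt Ct.
  rewrite /= !in_itv/= => /andP[ls sr] /andP[lt_ tr].
  have [y [Cy [u /=]]] := Hgap j; rewrite in_itv/= => /andP[ru ul] uy.
  (* Missed points in two different subarcs would trap the image, which visits the gap between them,
     inside [e]; but it also meets the interior of [e']. *)
  suff /(_ _ Cz)[v] : iter m f @` J i `<=` g e @` `]s, t[.
    rewrite /= in_itv/= => /andP[sv vt]; rewrite -wz => vw.
    have v01 : 0 < v < 1.
      rewrite (le_lt_trans _ sv)/=; last by rewrite (le_trans a0)// (le_trans (al j)).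
      by rewrite (lt_le_trans vt)// (le_trans tr)// (le_trans (ltW (rl _)))// (le_trans (bl _ _)).
    have w01' : 0 <= w <= 1 by move: w01; rewrite /= in_itv/= => /andP[? ?]; rewrite !ltW.
    have [ee' _] := arc_disj Gg v01 w01' vw.
    by rewrite ee' eqxx in e'e.
  apply: (@arc_separation _ _ _ _ _ Gg e s t u) => //.
  - apply: connected_image; first exact: iter_continuous.
    exact: path_connected (arc_cont Gg e).
  - by rewrite (le_trans a0)// (le_trans (al j)).
  - by rewrite (le_trans tr)// (le_trans (ltW (rl _)))// (le_trans (bl _ _)).
  - rewrite (le_lt_trans sr ru)/= (lt_le_trans ul)// (le_trans _ lt_)//.
    exact: ll.
  - by rewrite uy.
  - by rewrite ps.
  - by rewrite qt.
(* The successor makes the return time [M' + M'] positive, as [eventually_image_sup] asks. *)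
pose M' := M.+1; have MM' : (M <= M')%N by exact: leqnSn.
have [j [x /and3P[/asboolP jx /asboolP xj /asboolP xj1]]] :=
  two_step_loop (fun i j k => @miss M' i j k MM')
                (fun i j k => @miss M'.+1 i j k (leqW MM')).
exists (l j), (r j); split => //.
  by rewrite (le_trans (ltW (rl _)))// bl.
exists ((M' + M') * (M' + M'))%N; apply: eventually_image_sup => //.
  by rewrite image_iterD; apply: subset_trans xj _; exact: image_subset.
rewrite -addSn image_iterD; apply: subset_trans xj1 _; exact: image_subset.
Qed.

Lemma exhaustion_exists : ~ exact_map f -> exists D, exhaustion f D.
Proof.
move=> /existsNP[U /not_implyP[oU /not_implyP[U0 /forallNP UT]]].
have [e [a [b [a0 ab b1 abU]]]] := arc_in_open Gg oU U0.
have [c [d [ac cd db [N HN]]]] := self_covering_arc e a0 ab b1.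
set J := g e @` `[c, d] in HN.
have JU : J `<=` U.
  move=> y [t /=]; rewrite in_itv/= => /andP[ct td] <-; apply: abU; exists t => //=.
  by rewrite in_itv/= (le_trans ac ct) (le_trans td db).
have Jmono n m : (N <= m)%N -> iter n f @` J `<=` iter (n + m) f @` J.
  by move=> Nm; rewrite image_iterD; apply: image_subset; exact: HN.
(* An image of [J] need not lie in the next one, only in those at least [N] steps later. In a window
   of [N.+1] consecutive images, the one that drops out is contained in the one that enters, [N.+1]
   steps later. All images in the window contain [J], so the union is connected. *)
pose D n := \bigcup_(i in `I_N.+1) iter (n + N + i) f @` J.
have oJ : open (g e @` `]c, d[).
  by apply: (arc_open e Gg); [exact: le_trans ac|exact: le_trans b1].
have cJ : g e @` `]c, d[ `<=` J.
  by move=> y [t /=]; rewrite in_itv/= => /andP[ct td] <-; exists t => //=;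
    rewrite in_itv/= !ltW.
exists D; split.
- move=> n; apply: closed_bigcup; first exact: finite_II.
  move=> i _; apply: compact_closed; first exact: metric_hausdorff.
  apply: compact_image; first exact: iter_continuous.
  exact: path_compact (arc_cont Gg e).
- move=> n; apply: bigcup_connected.
    exists (g e c) => i _; apply: HN; first by rewrite addnAC leq_addl.
    by exists c => //=; rewrite in_itv/= lexx ltW.
  move=> i _; apply: connected_image; first exact: iter_continuous.
  exact: path_connected (arc_cont Gg e).
- move=> n x [i /= iN]; case: i iN => [_|i iN] xi.
    exists N; first exact: ltnSn.
    have := @Jmono (n + N + 0)%N N.+1 (leqnSn N); move=> /(_ _ xi).
    by congr ((iter _ f @` J) x); lia.
  exists i; first exact: ltnW.
  by move: xi; congr ((iter _ f @` J) x); lia.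
- by move=> n; rewrite image_bigcup; apply: eq_bigcupr => i _; rewrite image_iterS.
(* Every image in the window lies in the image of [J] at the common time [n + N + (N + N)], which is
   at least [N] steps later; and no image of [U] is the whole space. *)
- move=> n DT; apply: (UT (n + N + (N + N))%N); apply/seteqP; split => // x _.
  have : D n x by rewrite DT.
  move=> [i /= iN xi]; have [//|y Jy yx] := @Jmono _ (N + N - i)%N _ _ xi; first lia.
  exists y; first exact: JU.
  by rewrite -yx; congr (iter _ f y); lia.
- move=> V oV V0; have [M _ HM] := mf oJ oV (arc_open_neq0 _ cd) V0.
  have [|x [[y Jy yx] Vx]] := HM (M + N + 0)%N; first by rewrite addn0 leq_addr.
  by exists M, x; split => //; exists 0%N => //; exists y => //; exact: cJ.
Qed.

End exhaustion_exists.

(** * Ends of an exhaustion *)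

Lemma exh_le (T : topologicalType) (f : T -> T) (D : nat -> set T) m n :
  exhaustion f D -> (m <= n)%N -> D m `<=` D n.
Proof.
move=> fD /subnK <-; elim: (n - m)%N => [//|k IHk].
by apply: subset_trans IHk _; exact: (exh_sub fD).
Qed.

Lemma finite_uniform_nat (E : finType) (P : E -> nat -> Prop) :
  (forall e m n, (m <= n)%N -> P e m -> P e n) ->
  (forall e, exists n, P e n) -> exists n, forall e, P e n.
Proof.
move=> Pmono /choice[n Pn]; exists (\max_e n e)%N => e.
by apply: Pmono (Pn e); exact: leq_bigmax.
Qed.

Lemma finite_uniform_pos (R : realType) (E : finType) (P : E -> R -> Prop) :
  (forall e c d, 0 < c -> c <= d -> P e d -> P e c) ->
  (forall e, exists2 c, 0 < c & P e c) -> exists2 c, 0 < c & forall e, P e c.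
Proof.
move=> Pmono Pex; have /choice[c cP] : forall e, exists c, 0 < c /\ P e c.
  by move=> e; have [c] := Pex e; exists c.
have c0 e : 0 < c e by have [] := cP e.
have Pc e : P e (c e) by have [] := cP e.
have m0 : 0 < \big[Num.min/1]_e c e by apply: lt_bigmin.
by exists (\big[Num.min/1]_e c e) => // e; apply: Pmono (Pc e) => //; exact: bigmin_le_cond.
Qed.

(** A cluster point of a choice of points. The sets need not be closed, so [x] may belong to none of
    them; they will be the relatively open missing parts of an arc. *)
Lemma nested_limit_point (R : realType) (M : nat -> set R) :
  (forall n, M n.+1 `<=` M n) -> (forall n, M n !=set0) ->
  (forall n, M n `<=` `[0, 1]) ->
  exists2 x, 0 <= x <= 1 & forall n r, 0 < r -> exists2 t, M n t & `|t - x| < r.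
Proof.
move=> Msub M0 M01; have /choice[t Mt] : forall n, exists t, M n t := M0.
have Mle m n : (m <= n)%N -> M n `<=` M m.
  move=> /subnK <-; elim: (n - m)%N => [//|k IHk].
  exact: subset_trans (Msub _) IHk.
have [|x [x01 xcl]] := @segment_compact R 0 1 (t n @[n --> \oo]) _.
  by exists 0%N => // n _; apply: (M01 n); exact: Mt.
exists x; first by move: x01; rewrite /= in_itv.
move=> n r r0; have [|s [Ms xs]] := xcl (M n) (ball x r) _ (nbhsx_ballx _ _ r0).
  by exists n => // m /= nm; apply: (Mle _ _ nm); exact: Mt.
by exists s => //; rewrite distrC.
Qed.

Definition cut (R : realType) (T : Type) (D : nat -> set T) (h : R -> T) :=
  forall n, exists2 t, 0 <= t <= 1 & ~ D n (h t).

(** The normal form of an end. Parameter 0 is left free: the start may belong to [D n] through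
    another arc that shares it. *)
Record cut_at_start (R : realType) (T : Type) (D : nat -> set T) (h : R -> T) :
  Prop := CutAtStart {
    cut_near0 : forall n, exists2 c, 0 < c & forall t, 0 < t < c -> ~ D n (h t);
    cut_away0 : forall c, 0 < c -> exists n, forall t, c <= t <= 1 -> D n (h t) }.

(** Missing points accumulate at [x] and the missing part is convex from time [N] on, so a missing
    point beyond [x] drags everything between [x] and itself along. *)
Lemma cut_at_limit (R : realType) (T : topologicalType) (f : T -> T)
    (D : nat -> set T) (h : R -> T) (x : R) (N : nat) :
  exhaustion f D -> continuous h -> 0 <= x < 1 ->
  (forall n s t u, (N <= n)%N -> 0 <= s -> s < t -> t < u -> u <= 1 ->
     ~ D n (h s) -> ~ D n (h u) -> ~ D n (h t)) ->
  (forall n r, 0 < r ->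
     exists2 t, 0 <= t <= 1 /\ ~ D n (h t) & `|t - x| < r) ->
  (forall s t, 0 <= s -> s < t -> t <= 1 -> exists n u, s < u < t /\ D n (h u)) ->
  cut D (fun t => h (x + t * (1 - x))) ->
  cut_at_start D (fun t => h (x + t * (1 - x))).
Proof.
move=> fD ch /andP[x0 x1] conv lim dense cutD.
have mono m n u : (m <= n)%N -> ~ D n (h u) -> ~ D m (h u).
  by move=> mn nD mD; apply: nD; exact: (exh_le fD mn).
have between n y u : (N <= n)%N -> x < y -> y < u -> u <= 1 ->
    ~ D n (h u) -> ~ D n (h y).
  move=> Nn xy yu u1 nDu; have [|s [/andP[s0 s1] nDs]] := lim n (y - x).
    by rewrite subr_gt0.
  rewrite ltr_norml => /andP[_ sy].
  by apply: (conv n s y u) => //; lra.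
split=> [n|c c0].
  have [t /andP[t0 t1] nDt] := cutD (maxn n N).
  (* If the missing point found is [x] itself, closedness of [D] gives another one strictly to its
     right. *)
  have [u [xu u1 nDu]] : exists u, [/\ x < u, u <= 1 & ~ D (maxn n N) (h u)].
    have [t00|tn0] := eqVneq t 0; last first.
      have {}t0 : 0 < t by rewrite lt_neqAle eq_sym tn0.
      exists (x + t * (1 - x)); split => //.
        by rewrite ltrDl mulr_gt0// subr_gt0.
      have : t * (1 - x) <= 1 - x by rewrite ler_piMl// subr_ge0 ltW.
      lra.
    move: nDt; rewrite t00 mul0r addr0 => nDx.
    have : nbhs x (h @^-1` (~` D (maxn n N))).
      apply: ch; apply: open_nbhs_nbhs; split => //.
      by apply: closed_openC; exact: (exh_closed fD _).
    move=> /nbhs_ballP[r /= r0 rD].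
    exists (Num.min 1 (x + r / 2)); split.
    - by rewrite lt_min x1; lra.
    - by rewrite ge_min lexx.
    - apply: rD; rewrite /ball/= ltr_distlC; apply/andP; split.
        by rewrite lt_min; apply/andP; split; lra.
      by rewrite gt_min; apply/orP; right; lra.
  exists ((u - x) / (1 - x)); first by rewrite divr_gt0 ?subr_gt0.
  move=> s /andP[s0]; rewrite ltr_pdivlMr ?subr_gt0// => su.
  apply: (mono _ _ _ (leq_maxl n N)).
  apply: (between _ _ u) => //; first exact: leq_maxr.
    by rewrite ltrDl mulr_gt0// subr_gt0.
  lra.
(* Missing points beyond [c] at all times would keep a whole subarc after [x] out of every [D n],
   against density. *)
apply: contrapT => /forallNP H.
have c1 : c <= 1.
  have [t /not_implyP[/andP[ct t1] _]] := (existsNP _).2 (H 0%N).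
  exact: le_trans t1.
have x1x : 0 < 1 - x by rewrite subr_gt0.
have cx : 0 < c * (1 - x) by rewrite mulr_gt0.
have cx1 : c * (1 - x) <= 1 - x by rewrite ler_piMl// ltW.
have [||n [u [/andP[xu uc] Du]]] := dense x (x + c * (1 - x)) x0; [lra|lra|].
have [t /not_implyP[/andP[ct t1] nDt]] := (existsNP _).2 (H (maxn n N)).
apply: (mono _ _ _ (leq_maxl n N)) Du.
have ctx : c * (1 - x) <= t * (1 - x) by rewrite ler_pM2r.
have tx1 : t * (1 - x) <= 1 - x by rewrite ler_piMl// ltW.
apply: (between _ _ (x + t * (1 - x))) => //; first exact: leq_maxr.
  lra.
lra.
Qed.

Section split_arcs.
Context {R : realType} {G : metricType R} {E : finType} {g : E -> R -> G}.
Context {x : E -> R} (x01 : forall e, 0 <= x e <= 1).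

(** The two pieces of an arc cut at [x e], both to be parametrised away from [x e], so that this
    point gets parameter 0. Pieces of length zero are excluded, since an arc has distinct ends. *)
Definition half := {s : E * bool | if s.2 then x s.1 < 1 else 0 < x s.1}.

Definition split_arc (s : half) (t : R) : G :=
  if (val s).2 then g (val s).1 (x (val s).1 + t * (1 - x (val s).1))
  else g (val s).1 (x (val s).1 - t * x (val s).1).

Lemma split_arcs A : arcs A g -> arcs A split_arc.
Proof.
move=> Ag.
have lex (y t : R) : 0 <= y -> 0 <= t <= 1 -> 0 <= t * y <= y.
  by move=> y0 /andP[t0 t1]; rewrite mulr_ge0//= ler_piMl.
have ltx (y t : R) : 0 < y -> 0 < t < 1 -> 0 < t * y < y.
  by move=> y0 /andP[t0 t1]; rewrite mulr_gt0//= gtr_pMl.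
split.
- move=> [[e b] /= eb]; rewrite /split_arc/=; case: b eb => _ t.
    apply: (@continuous_comp _ _ _ (fun t : R => x e + t * (1 - x e))); last exact: (arc_cont Ag).
    by apply: cvgD; [exact: cvg_cst|apply: cvgMl; exact: cvg_id].
  apply: (@continuous_comp _ _ _ (fun t : R => x e - t * x e)); last exact: (arc_cont Ag).
  by apply: cvgB; [exact: cvg_cst|apply: cvgMl; exact: cvg_id].
- move=> [[e b] /= eb] [[e' b'] /= eb'] t t' t01 t'01; rewrite /split_arc/=.
  have /andP[xe0 xe1] := x01 e; have /andP[xe'0 xe'1] := x01 e'.
  case: b eb => eb; case: b' eb' => eb' /(arc_disj Ag).
  + have /andP[? ?] : 0 < t * (1 - x e) < 1 - x e by apply: ltx => //; rewrite subr_gt0.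
    have /andP[? ?] : 0 <= t' * (1 - x e') <= 1 - x e' by apply: lex => //; rewrite subr_ge0.
    case; [by apply/andP; split; lra|by apply/andP; split; lra|].
    move=> ee'; subst e' => xx; split; first exact/val_inj.
    by move/addrI/mulIf : xx; apply; rewrite gt_eqF// subr_gt0.
  + have /andP[? ?] : 0 < t * (1 - x e) < 1 - x e by apply: ltx => //; rewrite subr_gt0.
    have /andP[? ?] : 0 <= t' * x e' <= x e' by apply: lex.
    case; [by apply/andP; split; lra|by apply/andP; split; lra|].
    by move=> ee'; subst e'; lra.
  + have /andP[? ?] : 0 < t * x e < x e by apply: ltx.
    have /andP[? ?] : 0 <= t' * (1 - x e') <= 1 - x e' by apply: lex => //; rewrite subr_ge0.
    case; [by apply/andP; split; lra|by apply/andP; split; lra|].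
    by move=> ee'; subst e'; lra.
  + have /andP[? ?] : 0 < t * x e < x e by apply: ltx.
    have /andP[? ?] : 0 <= t' * x e' <= x e' by apply: lex.
    case; [by apply/andP; split; lra|by apply/andP; split; lra|].
    move=> ee'; subst e' => xx; split; first exact/val_inj.
    by move/addrI/oppr_inj/mulIf : xx; apply; rewrite gt_eqF.
- move=> [[e b] /= eb]; rewrite /split_arc/=; have /andP[xe0 xe1] := x01 e.
  case: b eb => eb; rewrite !mul1r mul0r ?addr0 ?subr0 => /(arc_inj Ag).
    by rewrite subrKC x01 ler01 lexx => /(_ isT isT) xe; rewrite xe ltxx in eb.
  by rewrite subrr x01 ler01 lexx => /(_ isT isT) xe; rewrite xe ltxx in eb.
- rewrite (arc_cover Ag); apply/seteqP; split => [_ [e _ [t + <-]]|].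
    rewrite /= in_itv/= => /andP[t0 t1]; have /andP[xe0 xe1] := x01 e.
    have up : x e <= t -> x e < 1 ->
        (\bigcup_(s in [set: half]) split_arc s @` `[0, 1]) (g e t).
      move=> xt xe; exists (exist _ (e, true) xe : half) => //.
      exists ((t - x e) / (1 - x e)).
        rewrite /= in_itv/= divr_ge0 ?subr_ge0//=.
        by rewrite ler_pdivrMr ?subr_gt0// mul1r lerB.
      by rewrite /split_arc/= divfK ?subrKC// gt_eqF// subr_gt0.
    have dn : t <= x e -> 0 < x e ->
        (\bigcup_(s in [set: half]) split_arc s @` `[0, 1]) (g e t).
      move=> xt xe; exists (exist _ (e, false) xe : half) => //.
      exists ((x e - t) / x e).
        rewrite /= in_itv/= divr_ge0 ?subr_ge0//=.
        by rewrite ler_pdivrMr// mul1r gerBl.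
      by rewrite /split_arc/= divfK ?gt_eqF// subKr.
    case: (ltgtP t (x e)) => tx.
    + by apply: dn; [exact: ltW|exact: le_lt_trans tx].
    + by apply: up; [exact: ltW|exact: lt_le_trans t1].
    + have [xe|xe] := ltP (x e) 1; first by apply: up; rewrite ?tx.
      by apply: dn; rewrite ?tx// (lt_le_trans _ xe).
  move=> _ [[[e b] /= eb] _ [t + <-]]; rewrite /= in_itv/= => t01.
  have /andP[xe0 xe1] := x01 e; exists e => //.
  rewrite /split_arc/=; case: b eb => eb.
    have /andP[? ?] : 0 <= t * (1 - x e) <= 1 - x e by apply: lex => //; rewrite subr_ge0.
    by exists (x e + t * (1 - x e)) => //=; rewrite in_itv/=; apply/andP; split; lra.
  have /andP[? ?] : 0 <= t * x e <= x e by apply: lex.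
  by exists (x e - t * x e) => //=; rewrite in_itv/=; apply/andP; split; lra.
Qed.

End split_arcs.

(** The missing part of an arc is eventually convex: a point of [D n] between two missing ones would
    trap the connected set [D n] in this arc, while it meets the interior of every arc. By density
    nothing but a point can survive in all these parts, and the arc is split there. *)
Lemma arcs_cut_at_start (R : realType) (G : metricType R) (E : finType)
    (g : E -> R -> G) (f : G -> G) (D : nat -> set G) :
  arcs setT g -> (forall e : E, exists e', e' != e) -> exhaustion f D ->
  exists (E' : finType) (g' : E' -> R -> G),
    arcs setT g' /\ forall e, cut D (g' e) -> cut_at_start D (g' e).
Proof.
move=> Gg E2 fD.
have hit e a b : 0 <= a -> a < b -> b <= 1 -> exists n u, a < u < b /\ D n (g e u).
  move=> a0 ab b1; have [|n [y [Dy [u /= + uy]]]] := exh_dense fD (arc_open e Gg a0 b1).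
    exact: arc_open_neq0.
  by rewrite in_itv/= => aub; exists n, u; rewrite uy.
have [N HN] : exists N, forall e, exists2 u, 0 < u < 1 & D N (g e u).
  apply: (finite_uniform_nat (P := fun e n => exists2 u, 0 < u < 1 & D n (g e u))).
    by move=> e m n mn [u u01 Du]; exists u => //; exact: (exh_le fD mn).
  by move=> e; have [n [u [u01 Du]]] := hit e 0 1 (lexx 0) ltr01 (lexx 1); exists n, u.
have conv e n s t u : (N <= n)%N -> 0 <= s -> s < t -> t < u -> u <= 1 ->
    ~ D n (g e s) -> ~ D n (g e u) -> ~ D n (g e t).
  move=> Nn s0 st tu u1 nDs nDu Dt; have [e' e'e] := E2 e.
  have [w /andP[w0 w1] /(exh_le fD Nn) Dw] := HN e'.
  have := @arc_separation _ _ _ _ _ Gg e s u t (D n) (exh_connected fD n).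
  rewrite st tu => /(_ (@subsetT _ _) s0 u1 isT Dt nDs nDu _ Dw)[v].
  rewrite /= in_itv/= => /andP[sv vu] /(arc_disj Gg)[||ee' _].
  - by rewrite (le_lt_trans s0 sv) (lt_le_trans vu u1).
  - by rewrite !ltW.
  - by rewrite ee' eqxx in e'e.
have /choice[x x_lim] : forall e, exists x, 0 <= x <= 1 /\ (cut D (g e) ->
    forall n r, 0 < r -> exists2 t, 0 <= t <= 1 /\ ~ D n (g e t) & `|t - x| < r).
  (* An arc that is eventually swallowed needs no splitting, and [x = 0] leaves it whole. *)
  move=> e; have [ce|] := pselect (cut D (g e)); last first.
    by exists 0; rewrite lexx ler01.
  have [|||x x01 Hx] := @nested_limit_point R
    (fun n => [set t | 0 <= t <= 1 /\ ~ D n (g e t)]).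
  - by move=> n t [t01 nD]; split => // /(exh_sub fD).
  - by move=> n; have [t t01 nDt] := ce n; exists t.
  - by move=> n t [t01 _]; rewrite /= in_itv.
  - by exists x; split.
have x01 e : 0 <= x e <= 1 by have [] := x_lim e.
exists (@half R E x), (@split_arc R G E g x); split; first exact: split_arcs.
move=> [[e b] /= eb] cutD.
have /andP[xe0 xe1] := x01 e.
have lex (y t : R) : 0 <= y -> 0 <= t <= 1 -> 0 <= t * y <= y.
  by move=> y0 /andP[t0 t1]; rewrite mulr_ge0//= ler_piMl.
case: b eb cutD => /= eb cutD.
  have cute : cut D (g e).
    move=> n; have [t t01 nDt] := cutD n; exists (x e + t * (1 - x e)) => //.
    have /andP[? ?] : 0 <= t * (1 - x e) <= 1 - x e by apply: lex => //; rewrite subr_ge0.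
    by apply/andP; split; lra.
  apply: (@cut_at_limit _ _ f D (g e) (x e) N fD (arc_cont Gg e)) => //.
  - by rewrite xe0.
  - exact: conv.
  - exact: (x_lim e).2.
  - exact: hit.
have cute : cut D (g e).
  move=> n; have [t t01 nDt] := cutD n; exists (x e - t * x e) => //.
  have /andP[? ?] := lex _ _ xe0 t01.
  by apply/andP; split; lra.
(* The left piece is the right piece of the reversed arc. *)
pose h (t : R) := g e (1 - t).
have hE : split_arc (g := g) (exist _ (e, false) eb : @half R E x) =
          fun t => h (1 - x e + t * (1 - (1 - x e))).
  by apply/funext => t; rewrite /split_arc /h/=; congr (g e _); lra.
rewrite hE in cutD *.
apply: (@cut_at_limit _ _ f D h (1 - x e) N fD) => //.
- move=> t; apply: (@continuous_comp _ _ _ (fun t : R => 1 - t)); last exact: (arc_cont Gg).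
  by apply: cvgB; [exact: cvg_cst|exact: cvg_id].
- by apply/andP; split; lra.
- move=> n s t u Nn s0 st tu u1 nDs nDu.
  by apply: (conv e n (1 - u) (1 - t) (1 - s)) => //; lra.
- move=> n r r0; have [t [/andP[t0 t1] nDt] tx] := (x_lim e).2 cute n r r0.
  exists (1 - t); first by rewrite /h subKr; split => //; apply/andP; split; lra.
  by rewrite -normrN; apply: le_lt_trans tx; rewrite le_eqVlt; apply/orP; left; apply/eqP; congr `|_|; lra.
- move=> s t s0 st t1; have [|||n [u [/andP[tu us] Du]]] := hit e (1 - t) (1 - s).
  + by lra.
  + by lra.
  + by lra.
  by exists n, (1 - u); rewrite /h subKr; split => //; apply/andP; split; lra.
Qed.

(** * Dynamics on the ends *)

Lemma mixing_surjective (R : realType) (G : metricType R) (f : G -> G) :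
  compact [set: G] -> continuous f -> mixing f -> forall y, exists x, f x = y.
Proof.
move=> cG cf mf y; apply: contrapT => /forallNP fy.
have cfG : closed (f @` setT).
  by apply: compact_closed; [exact: metric_hausdorff|exact: compact_image].
have [||||N _ /(_ N.+1 (leqnSn N))[_ [[x _ <-]]]] := mf setT (~` (f @` setT)).
- exact: openT.
- exact: closed_openC.
- by exists y.
- by exists y => -[x _]; exact: fy.
by apply; exists (iter N f x).
Qed.

Lemma continuous_right0 (R : realType) (T : topologicalType) (h : R -> T) A :
  continuous h -> nbhs (h 0) A ->
  exists2 r, 0 < r & forall z, 0 <= z < r -> A (h z).
Proof.
move=> ch /ch /nbhs_ballP[r /= r0 rA]; exists r => // z /andP[z0 zr].
by apply: rA; rewrite /ball/= sub0r normrN ger0_norm.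
Qed.

Section ends_dynamics.
Context {R : realType} {G : metricType R} {E : finType} {g : E -> R -> G}.
Context {f : G -> G} {D : nat -> set G}.
Context (Gg : arcs setT g) (fD : exhaustion f D) (cf : continuous f).
Context (fsurj : forall y, exists x, f x = y).
Context (cut_start : forall e, cut D (g e) -> cut_at_start D (g e)).

(** A weak form of saying that [f] sends the end [t] to the end [s]: it asks only for arbitrarily
    close points, and [follows_near] upgrades it to a whole one-sided neighbourhood. *)
Definition follows (t s : E) := forall c, 0 < c ->
  exists z y, [/\ 0 < z < c, 0 < y < c & f (g t z) = g s y].

Lemma missing_small c : 0 < c -> exists n, forall p, ~ D n p ->
  exists t, cut D (g t) /\ exists2 z, 0 <= z <= 1 /\ z < c & p = g t z.
Proof.
move=> c0.
have [n Hn] : exists n, forall e t, 0 <= t <= 1 -> ~ D n (g e t) ->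
    cut D (g e) /\ t < c.
  apply: (finite_uniform_nat (P := fun e n => forall t, 0 <= t <= 1 ->
    ~ D n (g e t) -> cut D (g e) /\ t < c)).
    by move=> e m n mn Hm t t01 nDt; apply: Hm => // /(exh_le fD mn).
  move=> e; have [ce|] := pselect (cut D (g e)).
    have [n Hn] := cut_away0 (cut_start ce) c0; exists n => t /andP[_ t1] nDt.
    by split => //; rewrite ltNge; apply/negP => ct; apply/nDt/Hn; rewrite ct.
  move=> /existsNP[n Hn]; exists n => t t01 nDt.
  by case: Hn; exists t.
exists n => p nDp; have [e [t [t01 pt]]] := arc_coverP Gg (I : setT p).
rewrite pt in nDp *; have [ce tc] := Hn e t t01 nDp.
by exists e; split => //; exists t.
Qed.

Lemma image_arc_continuous t : continuous (f \o g t).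
Proof. by move=> x; apply: continuous_comp; [exact: (arc_cont Gg)|exact: cf]. Qed.

Lemma follows_start t s : follows t s -> f (g t 0) = g s 0.
Proof.
move=> ts; apply: metric_hausdorff => A B nA nB.
have [r1 r10 H1] := continuous_right0 (@image_arc_continuous t) nA.
have [r2 r20 H2] := continuous_right0 (arc_cont Gg s) nB.
have [|z [y [/andP[z0 zr] /andP[y0 yr] zy]]] := ts (Num.min r1 r2).
  by rewrite lt_min r10.
move: zr yr; rewrite !lt_min => /andP[zr _] /andP[_ yr].
exists (g s y); split; last by apply: H2; rewrite ltW.
by rewrite -zy; apply: (H1 z); rewrite ltW.
Qed.

(* An end of D can only be entered through a path that stays on its side:
   otherwise the image of a compact subarc of D would already reach the end. *)
Lemma follows_near t s d : cut D (g t) -> cut D (g s) -> follows t s ->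
  0 < d < 1 ->
  exists2 c, 0 < c & forall z, 0 < z < c ->
    exists2 y, 0 < y < d & f (g t z) = g s y.
Proof.
move=> ct cs ts /andP[d0 d1].
have cfg := @image_arc_continuous t.
(* The outer barrier: the start of [t] goes to the start of [s], so nearby images avoid [g s d]. *)
have nd : nbhs ((f \o g t) 0) (~` [set g s d]).
  apply: open_nbhs_nbhs; split.
    apply: closed_openC; apply: accessible_closed_set1.
    exact/hausdorff_accessible/metric_hausdorff.
  rewrite /= (follows_start ts) => s0d.
  have [||_ d0'] := arc_disj Gg (t := d) (t' := 0) _ _ (esym s0d).
  - by rewrite d0.
  - by rewrite lexx ler01.
  by rewrite d0' ltxx in d0.
have [r r0 Hr] := continuous_right0 cfg nd.
have [|z0 [y0 [/andP[z00 z0r] /andP[y00 y0r] zy0]]] := ts (Num.min (Num.min r 1) d).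
  by rewrite !lt_min r0 ltr01.
exists (Num.min r 1); first by rewrite lt_min r0 ltr01.
move=> z /andP[zz0]; rewrite lt_min => /andP[zr z1].
move: z0r y0r; rewrite !lt_min => /andP[/andP[z0r z01] _] /andP[_ y0d].
(* The subarc between [z] and a point [z0] known to land on [s] lies in some [D n]. Its image lies
   in [D n.+1], hence avoids small parameters of [s]: this is the inner barrier. *)
pose C := (f \o g t) @` `[Num.min z z0, Num.max z z0].
have m0 : 0 < Num.min z z0 by rewrite lt_min zz0.
have [n Hn] := cut_away0 (cut_start ct) m0.
have CD : C `<=` D n.+1.
  rewrite -(exh_image fD n) => p [u /=]; rewrite in_itv/= => /andP[mu uM] <-.
  exists (g t u) => //; apply: Hn; rewrite mu (le_trans uM)//.
  by rewrite ge_max !ltW.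
have [c2 c20 Hc2] := cut_near0 (cut_start cs) n.+1.
have my : 0 < Num.min y0 c2 by rewrite lt_min y00.
have hy : Num.min y0 c2 / 2 < Num.min y0 c2 by lra.
move: (hy); rewrite lt_min => /andP[hy0 hyc].
have Cz u : Num.min z z0 <= u <= Num.max z z0 -> C (f (g t u)).
  by move=> mu; exists u => //=; rewrite in_itv.
have sub : C `<=` g s @` `](Num.min y0 c2 / 2), d[.
  apply: (@arc_separation _ _ _ _ _ Gg s _ d y0 C) => //.
  - exact: path_connected.
  - lra.
  - exact: ltW.
  - by rewrite hy0.
  - by rewrite -zy0; apply: Cz; rewrite ge_min le_max lexx !orbT.
  - by move=> /CD; apply: Hc2; rewrite hyc andbT; lra.
  - move=> [u /=]; rewrite in_itv/= => /andP[mu uM]; apply: (Hr u).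
    by rewrite (le_trans (ltW m0) mu)/= (le_lt_trans uM)// gt_max zr.
have [|y /=] := sub (f (g t z)); first by apply: Cz; rewrite ge_min le_max lexx.
rewrite in_itv/= => /andP[y1 y2] yz; exists y => //.
by rewrite y2 andbT; lra.
Qed.

(** A point of [s] close enough to its start is outside [D n.+1], so its preimages are outside
    [D n], and [missing_small] puts them near the start of some end. Below a uniform threshold, that
    end must follow [s]. *)
Lemma end_preimage s d : cut D (g s) -> 0 < d ->
  exists2 c, 0 < c & forall y p, 0 < y < c -> f p = g s y ->
    exists t z, [/\ cut D (g t), follows t s, 0 < z < d & p = g t z].
Proof.
move=> cs d0.
have [c1 c10 Hc1] : exists2 c, 0 < c & forall t z y, 0 <= z < c -> z <= 1 ->
    0 < y < c -> f (g t z) = g s y -> follows t s /\ 0 < z.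
  apply: (finite_uniform_pos (P := fun t c => forall z y, 0 <= z < c -> z <= 1 ->
    0 < y < c -> f (g t z) = g s y -> follows t s /\ 0 < z)).
    move=> t c c' c0 cc' Hc' z y /andP[z0 zc] z1 /andP[y0 yc].
    by apply: Hc' => //; apply/andP; split => //; exact: lt_le_trans cc'.
  move=> t; have [ts|nts] := pselect (follows t s).
    exists 1 => // z y /andP[z0 _] z1 y01 zy; split => //.
    rewrite lt_neqAle z0 andbT; apply/eqP => z00.
    move: zy; rewrite -z00 (follows_start ts) => /esym /(arc_disj Gg y01).
    rewrite lexx ler01 => /(_ isT)[_ y00].
    by move: y01; rewrite y00 ltxx.
  move: nts => /existsNP[c0 /not_implyP[c00 Hc0]].
  have Hz z y : 0 < z < c0 -> 0 < y < c0 -> f (g t z) = g s y -> False.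
    by move=> zc yc zy; apply: Hc0; exists z, y.
  (* Parameter 0 escapes [follows]: the start of [t] may be sent into the interior of [s], and then
     only levels below that image are safe. *)
  have [[y0 y01 ty0]|nt0] := pselect (exists2 y, 0 < y < 1 & f (g t 0) = g s y).
    exists (Num.min c0 y0); first by rewrite lt_min c00; case/andP: y01.
    move=> z y; rewrite !lt_min => /andP[z0 /andP[zc zy0]] z1 /andP[y0' /andP[yc yy0]] zy.
    exfalso; have [z00|zn0] := eqVneq z 0; last first.
      by apply: (Hz z y) => //; [rewrite lt_neqAle eq_sym zn0 z0|rewrite y0'].
    move: zy; rewrite z00 ty0 => /(arc_disj Gg y01)[|_ yy].
      by rewrite ltW//= ltW// (lt_trans yy0)//; case/andP: y01.
    by rewrite yy ltxx in yy0.
  exists (Num.min c0 1); first by rewrite lt_min c00 ltr01.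
  move=> z y; rewrite !lt_min => /andP[z0 /andP[zc _]] z1 /andP[y0 /andP[yc y1]] zy.
  exfalso; have [z00|zn0] := eqVneq z 0; last first.
    by apply: (Hz z y) => //; [rewrite lt_neqAle eq_sym zn0 z0|rewrite y0].
  by apply: nt0; exists y; rewrite ?y0// -zy z00.
have cd0 : 0 < Num.min c1 d by rewrite lt_min c10.
have [n Hn] := missing_small cd0.
have [c2 c20 Hc2] := cut_near0 (cut_start cs) n.+1.
exists (Num.min c1 c2); first by rewrite lt_min c10.
move=> y p; rewrite lt_min => /andP[y0 /andP[yc1 yc2]] fp.
have [|t [ct [z [/andP[z0 z1]]]]] := Hn p.
  move=> Dp; apply: (Hc2 y); first by rewrite y0.
  by rewrite -fp -(exh_image fD n); exists p.
rewrite lt_min => /andP[zc1 zd] pz.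
have [||||ts zz0] := Hc1 t z y.
- by rewrite z0.
- by [].
- by rewrite y0.
- by rewrite -pz.
by exists t, z; rewrite zz0.
Qed.

(** Points near the start of [t] are sent to interior points of both [s] and [s'], and an interior
    point lies on one arc only. *)
Lemma follows_functional t s s' : cut D (g t) -> cut D (g s) -> cut D (g s') ->
  follows t s -> follows t s' -> s = s'.
Proof.
move=> ct cs cs' ts ts'.
have h01 : 0 < (1 / 2 : R) < 1 by lra.
have [c c0 Hc] := follows_near ct cs ts h01.
have [c' c'0 Hc'] := follows_near ct cs' ts' h01.
have m0 : 0 < Num.min c c' by rewrite lt_min c0.
have : Num.min c c' / 2 < Num.min c c' by lra.
rewrite lt_min => /andP[mc mc'].
have [|y /andP[y0 y1] yz] := Hc (Num.min c c' / 2); first by rewrite mc andbT; lra.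
have [|y' /andP[y'0 y'1] y'z] := Hc' (Num.min c c' / 2); first by rewrite mc' andbT; lra.
have yy' : g s y = g s' y' by rewrite -yz -y'z.
by case: (arc_disj Gg _ _ yy') => //; apply/andP; split; lra.
Qed.

Definition ends : {set E} := [set e | `[< cut D (g e) >]]%SET.

(** Surjectivity of [f] lets every end be followed by choosing a preimage end [pre]. As an end
    follows at most one end, [pre] is injective, hence a permutation, and [k] is the length of one
    of its cycles. *)
Lemma end_cycle : exists s k, [/\ (0 < k <= #|ends|)%N,
  forall d, 0 < d < 1 -> exists2 c, 0 < c & forall z, 0 < z < c ->
    exists2 y, 0 < y < d & iter k f (g s z) = g s y &
  forall d, 0 < d -> exists2 c, 0 < c & forall y p, 0 < y < c ->
    iter k f p = g s y -> exists2 z, 0 < z < d & p = g s z].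
Proof.
pose S := {e | e \in ends}.
have cutE (s : S) : cut D (g (val s)).
  by apply/asboolP; have := valP s; rewrite inE.
have inends t : cut D (g t) -> t \in ends by rewrite inE => ct; exact/asboolP.
(* Without ends, some [D n] would already be the whole space. *)
have [s0 _] : exists s : S, true.
  apply: contrapT => none; have [n Hn] := missing_small ltr01.
  apply: (exh_neqT fD (n := n)); apply/seteqP; split => // p _.
  apply: contrapT => /Hn[t [ct _]]; apply: none.
  by exists (exist _ t (inends _ ct)).
have /choice[pre preP] : forall s : S, exists t : S, follows (val t) (val s).
  move=> s; have [c c0 Hc] := end_preimage (cutE s) ltr01.
  have [p fp] := fsurj (g (val s) (c / 2)).
  have [|t [z [ct ts _ _]]] := Hc _ p _ fp; first by lra.
  by exists (exist _ t (inends _ ct)).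
have pre_inj : injective pre.
  move=> s s' ss'; apply/val_inj; apply: (follows_functional (cutE (pre s))) => //.
  by rewrite ss'.
(* Since [pre] is onto, every end is a chosen preimage, and it follows nothing but the end it was
   chosen for. So all preimages near [s] lie on the one arc [pre s]. *)
have preU (s t : S) : follows (val t) (val s) -> t = pre s.
  move=> ts; have [post _ postK] := injF_bij pre_inj.
  rewrite -[t]postK; congr pre; apply/val_inj.
  apply: (follows_functional (cutE t)) => //.
  by rewrite -[t in follows (val t) _]postK.
pose k := order pre s0; exists (val s0), k.
have ks0 : iter k pre s0 = s0 by exact: iter_order.
split.
- by rewrite order_gt0 (leq_trans (max_card _))// card_sig subset_leq_card//; exact/fintype.subsetP.
- have H i d : 0 < d < 1 -> exists2 c, 0 < c & forall z, 0 < z < c ->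
      exists2 y, 0 < y < d & iter i f (g (val (iter i pre s0)) z) = g (val s0) y.
    elim: i d => [|i IHi] d d01; first by exists d => [|z]; [case/andP: d01|exists z].
    have [c c0 Hc] := IHi d d01.
    have [|c' c'0 Hc'] := follows_near (d := Num.min c (1 / 2))
      (cutE _) (cutE _) (preP (iter i pre s0)).
      by rewrite lt_min c0 gt_min; apply/andP; split; [lra|apply/orP; right; lra].
    exists c' => // z /Hc'[y /andP[y0]]; rewrite lt_min => /andP[yc _] zy.
    have [|y' y'd yy'] := Hc y; first by rewrite y0.
    by exists y' => //; rewrite iterSr iterS zy.
  by move=> d /(H k); rewrite ks0.
- have H i d : 0 < d -> exists2 c, 0 < c & forall y p, 0 < y < c ->
      iter i f p = g (val s0) y -> exists2 z, 0 < z < d & p = g (val (iter i pre s0)) z.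
    elim: i d => [|i IHi] d d0; first by exists d => // y p yd /= py; exists y.
    have [c c0 Hc] := end_preimage (cutE (iter i pre s0)) d0.
    have [c' c'0 Hc'] := IHi c c0.
    exists c' => // y p yc'; rewrite iterSr => /(Hc' _ _ yc')[z zc fp].
    have [t [w [ct ts wd pw]]] := Hc z p zc fp.
    exists w => //; rewrite pw; congr (g _ w).
    by rewrite iterS -(preU _ (exist _ t (inends _ ct)) ts).
  by move=> d /(H k); rewrite ks0.
Qed.

End ends_dynamics.

(** * Horseshoes *)

Section real_horseshoe.
Context {R : realType}.
Implicit Types (phi psi : R -> R) (a b c d : R).

Lemma last_zero psi a b : continuous psi -> a < b -> psi a <= 0 -> 0 < psi b ->
  exists c, [/\ a <= c, c < b, psi c = 0 & forall x, c < x <= b -> 0 < psi x].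
Proof.
move=> cpsi ab pa pb; pose K := `[a, b] `&` psi @^-1` [set x | x <= 0].
have cK : compact K.
  apply: compact_closedI; first exact: segment_compact.
  by apply: preimage_closed; [move=> x _; exact: cpsi|exact: closed_le].
have K0 : K !=set0 by exists a; split => //=; rewrite in_itv/= lexx ltW.
have cid : {within K, continuous (fun x : R => x)}.
  by apply: continuous_subspaceT => x; exact: cvg_id.
have [c /set_mem[+ pc] cmax] := compact_EVT_max K0 cK cid.
rewrite /= in_itv/= => /andP[ac cb].
have pos x : c < x <= b -> 0 < psi x.
  move=> /andP[cx xb]; rewrite ltNge; apply/negP => px.
  have := cmax x; rewrite leNgt cx => /(_ _)/negP; apply => //.
  apply: mem_set; split => //=; rewrite in_itv/= xb andbT.
  exact: le_trans (ltW cx).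
have {}cb : c < b.
  by rewrite lt_neqAle cb andbT; apply: contraTneq pb => <-; rewrite -leNgt.
exists c; split => //.
have [||x + px] := @IVT _ psi c b 0 (ltW cb).
- exact: continuous_subspaceT.
- by rewrite ge_min pc/= le_max (ltW pb) orbT.
rewrite in_itv/= => /andP[cx xb].
have [<-//|xc] := eqVneq x c.
by have := pos x; rewrite px ltxx xb lt_neqAle eq_sym xc cx => /(_ isT).
Qed.

Lemma first_zero psi a b : continuous psi -> a < b -> psi a < 0 -> 0 <= psi b ->
  exists c, [/\ a < c, c <= b, psi c = 0 & forall x, a <= x < c -> psi x < 0].
Proof.
move=> cpsi ab pa pb.
have [||||c [bc ca pc pos]] := @last_zero (fun x => - psi (- x)) (- b) (- a).
- move=> x; apply: cvgN; apply: (@continuous_comp _ _ _ -%R psi); last exact: cpsi.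
  exact: opp_continuous.
- by rewrite ltrN2.
- by rewrite opprK oppr_le0.
- by rewrite opprK oppr_gt0.
exists (- c); split.
- by rewrite ltrNr.
- by rewrite lerNl.
- by apply/eqP; rewrite -oppr_eq0 pc.
- move=> x /andP[ax xc]; have := pos (- x); rewrite opprK oppr_gt0; apply.
  by rewrite lerN2 ax ltrNr xc.
Qed.

(* The four points bound three laps, each of which phi stretches over [a, b]. *)
Lemma low_high_low_high phi c d : continuous phi -> phi 0 = 0 ->
  0 < c <= d -> (forall x, 0 < x <= d -> 0 < phi x) ->
  (forall x, 0 < x < c -> exists z, 0 < z <= x /\ x < phi z) ->
  (forall x, 0 < x < c -> exists z, x <= z <= d /\ phi z < x) ->
  exists a z w b, [/\ 0 < a, a < z, z < w, w < b & b < c] /\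
    [/\ phi a = a, b < phi z, phi w < a & phi b = b].
Proof.
move=> cphi phi0 /andP[c0 cd] pos up down.
have cwphi (x y : R) : {within `[x, y], continuous phi} by exact: continuous_subspaceT.
have cid : continuous (fun x : R => phi x - x).
  by move=> x; apply: cvgB; [exact: cphi|exact: cvg_id].
have low_near0 (x : R) : 0 < x -> x <= d -> exists2 m, 0 < m &
    forall y, x <= y <= d -> m <= phi y.
  move=> x0 xd; have [m + Hm] := EVT_min xd (cwphi x d).
  rewrite in_itv/= => /andP[xm md]; exists (phi m).
    by apply: pos; rewrite md (lt_le_trans x0 xm).
  by move=> y xyd; apply: Hm; rewrite in_itv.
have [|x0 [/andP[x00 x0c] phix0]] := up (c / 2); first by lra.
have [||m m0 Hm] := low_near0 x0 => //; first by lra.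
have [r r0 Hr] : exists2 r, 0 < r & forall z, 0 <= z < r -> phi z < m.
  apply: (continuous_right0 (A := [set x | x < m]) cphi).
  by apply: open_nbhs_nbhs; split; [exact: open_lt|rewrite /= phi0].
(* [phi p] is below all values of [phi] on [[x0, d]], so the minimum over [[p, d]] is attained
   before [x0]. *)
pose p := Num.min x0 r / 2.
have p0 : 0 < p by rewrite divr_gt0// lt_min x00.
have [px0 pr] : p < x0 /\ p < r.
  have : p < Num.min x0 r by rewrite /p ltr_pdivrMr// ltr_pMr ?lt_min ?x00 ?ltr1n.
  by rewrite lt_min => /andP[].
have [|w0 + w0min] := @EVT_min _ phi p d _ (cwphi p d); first lra.
rewrite in_itv/= => /andP[pw0 w0d].
have w0x0 : w0 < x0.
  rewrite ltNge; apply/negP => x0w0.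
  have : m <= phi w0 by apply: Hm; rewrite x0w0.
  rewrite leNgt => /negP; apply; apply: le_lt_trans (Hr p _); last by rewrite ltW.
  by apply: w0min; rewrite in_itv/= lexx; lra.
have phiw0 : phi w0 < w0.
  have [|x [/andP[px xd] phix]] := down p; first by rewrite p0; lra.
  apply: lt_le_trans pw0; apply: le_lt_trans phix.
  by apply: w0min; rewrite in_itv/= px.
(* [w0] moves down and [x0] moves up. Taking the first fixed point after [w0] keeps [phi] below the
   diagonal until [b], so a point up to [b] that jumps over [b] must come before [w0]. *)
have [||b [w0b bx0 phib below]] := first_zero cid w0x0.
- by rewrite subr_lt0.
- by rewrite subr_ge0; lra.
have {}phib : phi b = b by lra.
have b0 : 0 < b by lra.
have [|z [/andP[z0 zb] phiz]] := up b; first by rewrite b0; lra.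
have zw0 : z < w0.
  rewrite ltNge; apply/negP => w0z; have zltb : z < b.
    by rewrite lt_neqAle zb andbT; apply/eqP => zb'; move: phiz; rewrite zb' phib ltxx.
  by have := below z; rewrite w0z zltb => /(_ isT); lra.
have [||m' m'0 Hm'] := low_near0 z => //; first by lra.
(* The same device at [z]: a point that drops below [q] comes before [z]. Taking the last fixed
   point [a] before [z] keeps [phi] above the diagonal up to [z], so a point from [a] on that drops
   below [a] comes after [z]. *)
pose q := Num.min z m' / 2.
have q0 : 0 < q by rewrite divr_gt0// lt_min z0.
have [qz qm'] : q < z /\ q < m'.
  have : q < Num.min z m' by rewrite /q ltr_pdivrMr// ltr_pMr ?lt_min ?z0 ?ltr1n.
  by rewrite lt_min => /andP[].
have [|x1 [/andP[qx1 x1d] phix1]] := down q; first by rewrite q0; lra.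
have x1z : x1 < z.
  rewrite ltNge; apply/negP => zx1; have : m' <= phi x1 by apply: Hm'; rewrite zx1.
  by lra.
have [||a [x1a az phia above]] := last_zero cid x1z.
- by rewrite subr_le0; lra.
- by rewrite subr_gt0; lra.
have {}phia : phi a = a by lra.
have [|x [/andP[ax xd] phix]] := down a; first by apply/andP; split; lra.
have zx : z < x.
  rewrite ltNge; apply/negP => xz; have : a != x.
    by apply/eqP => ax'; move: phix; rewrite -ax' phia ltxx.
  rewrite neq_lt [x < a]ltNge ax orbF => {}ax.
  by have := above x; rewrite ax xz => /(_ isT); lra.
have [xb|bx] := ltP x b.
  by exists a, z, x, b; split; split => //; lra.
(* A low point beyond [b] is replaced by [w0], which is at least as low because it minimizes [phi]
   on [[p, d]]. *)
exists a, z, w0, b; split; split => //; try lra.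
apply: le_lt_trans phix; apply: w0min; rewrite in_itv/= xd andbT; lra.
Qed.

(** The laps between the four points share [z] and [w]. The strict inequalities there survive on
    small neighbourhoods, whose removal makes the laps disjoint, as separation of orbits
    requires. *)
Lemma strict_horseshoe phi a z w b : continuous phi -> a < z -> z < w -> w < b ->
  phi a = a -> b < phi z -> phi w < a -> phi b = b ->
  exists l r : 'I_3 -> R,
    [/\ forall i, a <= l i /\ r i <= b, forall i j : 'I_3, (i < j)%N -> r i < l j &
      forall i y, a <= y <= b -> exists2 x, l i <= x <= r i & phi x = y].
Proof.
move=> cphi az zw wb phia phiz phiw phib.
have cwphi (x y : R) : {within `[x, y], continuous phi} by exact: continuous_subspaceT.
have nearby (x : R) (A : set R) : open A -> A (phi x) ->
    exists2 r, 0 < r & forall y, `|y - x| < r -> A (phi y).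
  move=> oA Ax; have : nbhs (phi x) A by exact: open_nbhs_nbhs.
  move=> /cphi /nbhs_ballP[r /= r0 rA]; exists r => // y yx.
  by apply: rA; rewrite /ball/= distrC.
have [rz rz0 Hz] := nearby z _ (@open_gt _ b) phiz.
have [rw rw0 Hw] := nearby w _ (@open_lt _ a) phiw.
pose m := Num.min (Num.min rz rw) (Num.min (z - a) (Num.min (w - z) (b - w))).
have m0 : 0 < m by rewrite !lt_min rz0 rw0 !subr_gt0 az zw wb.
have [mrz mrw mza mwz mbw] :
    [/\ m <= rz, m <= rw, m <= z - a, m <= w - z & m <= b - w].
  by rewrite /m !ge_min !lexx !orbT.
(* A third of [m] suffices: the gap between [z] and [w] loses [e] on both sides and still has
   positive length. *)
have [e [[e0 erz erw] [az' zw' wb']]] : exists e, [/\ 0 < e, e < rz & e < rw] /\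
    [/\ a < z - e, z + e < w - e & w + e < b].
  by exists (m / 3); move: m0 mrz mrw mza mwz mbw; move: m => m *;
    split; split; lra.
have near_z (x : R) : z - e <= x <= z + e -> b < phi x.
  move=> /andP[? ?]; apply: Hz; rewrite ltr_norml; apply/andP; split; lra.
have near_w (x : R) : w - e <= x <= w + e -> phi x < a.
  move=> /andP[? ?]; apply: Hw; rewrite ltr_norml; apply/andP; split; lra.
have lap (x y v : R) : x <= y -> Num.min (phi x) (phi y) <= a ->
    b <= Num.max (phi x) (phi y) -> a <= v <= b ->
    exists2 t, x <= t <= y & phi t = v.
  move=> xy mn mx /andP[av vb]; have [|t] := IVT xy (cwphi x y) (v := v).
    by rewrite (le_trans mn av) (le_trans vb mx).
  by rewrite in_itv/= => txy phit; exists t.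
have w2 : phi (w + e) < a by apply: near_w; apply/andP; split; lra.
have w1 : phi (w - e) < a by apply: near_w; apply/andP; split; lra.
have z2 : b < phi (z + e) by apply: near_z; apply/andP; split; lra.
have z1 : b < phi (z - e) by apply: near_z; apply/andP; split; lra.
exists (fun i => nth 0 [:: a; z + e; w + e] i).
exists (fun i => nth 0 [:: z - e; w - e; b] i); split.
- by case=> -[|[|[|]]]//= _; split; lra.
- by case=> -[|[|[|]]]//= _; case=> -[|[|[|]]]//= _ _; lra.
- case=> -[|[|[|]]]//= _ v vab; apply: lap => //; try lra.
  + by rewrite ge_min phia lexx.
  + by rewrite le_max (ltW z1) orbT.
  + by rewrite ge_min (ltW w1) orbT.
  + by rewrite le_max (ltW z2).
  + by rewrite ge_min (ltW w2).
  + by rewrite le_max phib lexx orbT.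
Qed.

End real_horseshoe.

(** Each point of the first image has a positive distance to the second, which is closed;
    compactness of the first makes the bound uniform. *)
Lemma disjoint_images_separated (R : realType) (G : metricType R) (h : R -> G)
    (a b c d : R) : continuous h ->
  (forall s t, a <= s <= b -> c <= t <= d -> h s <> h t) ->
  exists2 eps, 0 < eps & forall s t, a <= s <= b -> c <= t <= d ->
    eps < mdist (h s) (h t).
Proof.
move=> ch hd.
have clK : closed (h @` `[c, d]) := path_closed (@metric_hausdorff R G) ch.
have [e /= e0 He] : \forall eps \near 0^'+, forall x, (h @` `[a, b]) x ->
    forall t, c <= t <= d -> eps < mdist x (h t).
  have /compact_near_coveringP := @path_compact R G h a b ch.
  move=> /(_ _ 0^'+ (fun eps x => forall t, c <= t <= d -> eps < mdist x (h t)) _).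
  apply=> _ [s /= + <-]; rewrite in_itv/= => sab.
  have : nbhs (h s) (~` (h @` `[c, d])).
    apply: open_nbhs_nbhs; split; first exact: closed_openC.
    by move=> [t /=]; rewrite in_itv/= => tcd /esym; exact: hd.
  move=> /nbhs_ballP[r /= r0 rK].
  exists (ball (h s) (r / 2), [set eps | eps < r / 2]).
    split; first by apply: nbhsx_ballx; rewrite divr_gt0.
    by apply: nbhs_right_lt; rewrite divr_gt0.
  move=> [x eps] /= [sx epsr] t tcd; apply: lt_le_trans epsr _.
  have rst : r <= mdist (h s) (h t).
    rewrite leNgt; apply/negP => st; apply: (rK (h t)).
      by rewrite ballEmdist.
    by exists t => //=; rewrite in_itv.
  have := metric_triangle (h s) x (h t).
  by move: sx; rewrite ballEmdist/= => ?; lra.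
have e20 : 0 < e / 2 by rewrite divr_gt0.
exists (e / 2) => // s t sab tcd.
apply: (He (e / 2)) => //=; last by exists s => //=; rewrite in_itv.
by rewrite sub0r normrN gtr0_norm// ltr_pdivrMr// ltr_pMr// ltr1n.
Qed.

Section horseshoe_entropy.
Context {R : realType} {G : metricType R} (f : G -> G) (k : nat) (h : R -> G).
Context (phi : R -> R) (a b : R) (l r : 'I_3 -> R).
Context (k0 : (0 < k)%N) (ch : continuous h) (ab : a <= b).
Context (h_inj : forall s t, a <= s <= b -> a <= t <= b -> h s = h t -> s = t).
Context (hphi : forall t, a <= t <= b -> iter k f (h t) = h (phi t)).
Context (lr_ab : forall i, a <= l i /\ r i <= b).
Context (lr_lt : forall i j : 'I_3, (i < j)%N -> r i < l j).
Context (lap : forall i y, a <= y <= b -> exists2 x, l i <= x <= r i & phi x = y).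

Lemma laps_separated : exists2 eps, 0 < eps & forall (i j : 'I_3) s t, i != j ->
  l i <= s <= r i -> l j <= t <= r j -> eps < mdist (h s) (h t).
Proof.
have [eps eps0 H] : exists2 eps, 0 < eps & forall p : 'I_3 * 'I_3, p.1 != p.2 ->
    forall s t, l p.1 <= s <= r p.1 -> l p.2 <= t <= r p.2 -> eps < mdist (h s) (h t).
  apply: (finite_uniform_pos (P := fun (p : 'I_3 * 'I_3) eps => p.1 != p.2 ->
    forall s t, l p.1 <= s <= r p.1 -> l p.2 <= t <= r p.2 -> eps < mdist (h s) (h t))).
    by move=> p c d c0 cd Hd p12 s t sp tp; apply: le_lt_trans cd _; exact: Hd.
  move=> [i j] /=; have [<-|ij] := eqVneq i j; first by exists 1.
  have [|e e0 He] := disjoint_images_separated (a := l i) (b := r i)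
      (c := l j) (d := r j) ch; last by exists e.
  have [? ?] := lr_ab i; have [? ?] := lr_ab j.
  move=> s t /andP[? ?] /andP[? ?] /h_inj st.
  have {}st : s = t by apply: st; apply/andP; split; lra.
  move: ij; rewrite neq_ltn => /orP[] /lr_lt; lra.
by exists eps => // i j s t ij; exact: (H (i, j)).
Qed.

(** Words of length [n] over the three laps are realized as itineraries under the [k]-th iterate, by
    pulling [a] back lap after lap. Words with different letters at place [j] are in different laps
    at time [j * k]. *)
Lemma horseshoe_separation_number : exists2 eps, 0 < eps &
  forall n, (((3 ^ n)%:R : R)%:E <= separation_number f (k * n) eps)%E.
Proof.
have [eps eps0 Heps] := laps_separated; exists eps => // n.
have /choice[pre0 preP0] : forall p : 'I_3 * R, exists x, a <= p.2 <= b ->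
    l p.1 <= x <= r p.1 /\ phi x = p.2.
  move=> [i y] /=; have [yab|_] := boolP (a <= y <= b); last by exists 0.
  by have [x ? ?] := lap i yab; exists x.
pose pre i y := pre0 (i, y).
have preP i y : a <= y <= b -> l i <= pre i y <= r i /\ phi (pre i y) = y.
  exact: (preP0 (i, y)).
pose pt (u : seq 'I_3) := foldr pre a u.
have ptab u : a <= pt u <= b.
  elim: u => [|i u IHu] /=; first by rewrite lexx.
  have [/andP[? ?] _] := preP i _ IHu; have [? ?] := lr_ab i.
  by apply/andP; split; lra.
have iter_pt j u : (j <= size u)%N -> iter (j * k) f (h (pt u)) = h (pt (drop j u)).
  elim: j u => [|j IHj] [|i u] //= ju.
  rewrite mulSn addnC iterD hphi; last exact: (ptab (i :: u)).
  by rewrite (preP i _ (ptab u)).2; exact: IHj.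
have sep (u v : n.-tuple 'I_3) : u != v ->
    exists2 j, (j < k * n)%N & eps < mdist (iter j f (h (pt u))) (iter j f (h (pt v))).
  move=> uv; have [j uvj] : exists j, tnth u j != tnth v j.
    apply: contrapT => /forallNP H; move/eqP: uv; apply; apply: eq_from_tnth => j.
    by apply/eqP/negPn/negP; exact: H.
  exists (j * k)%N; first by rewrite mulnC ltn_pmul2l.
  have hd (w : n.-tuple 'I_3) :
      drop j w = tnth w j :: drop j.+1 w.
    by rewrite (tnth_nth ord0) -drop_nth ?size_tuple.
  have jn (w : n.-tuple 'I_3) : (j <= size w)%N by rewrite size_tuple ltnW.
  rewrite (iter_pt _ _ (jn u)) (iter_pt _ _ (jn v)) (hd u) (hd v).
  apply: (Heps _ _ _ _ uvj); first exact: (preP _ _ (ptab _)).1.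
  exact: (preP _ _ (ptab _)).1.
pose s := [seq h (pt u) | u : n.-tuple 'I_3].
have hinj (u v : n.-tuple 'I_3) : h (pt u) = h (pt v) -> u = v.
  move=> uv; apply/eqP; apply: contrapT => /negP/sep[j _].
  by rewrite uv mdistxx ltNge ltW.
have sep_s : separated_seq f (k * n) eps s.
  split; first by rewrite map_inj_uniq ?enum_uniq//; exact: hinj.
  move=> _ _ /mapP[u _ ->] /mapP[v _ ->] uv; apply: sep.
  by apply: contraNneq uv => ->.
have <- : size s = (3 ^ n)%N by rewrite size_map -cardE card_tuple card_ord.
by apply: ereal_sup_ubound; exists s.
Qed.

Lemma horseshoe_entropy : ((ln 3 / k%:R)%:E <= topological_entropy f)%E.
Proof.
have [eps eps0 Heps] := horseshoe_separation_number.
apply: le_trans (ereal_sup_ubound _); last by exists eps => /=.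
rewrite limn_esup_lim; apply: lime_ge; first exact: is_cvg_esups.
near=> n.
apply: le_trans (ereal_sup_ubound _); last first.
  (* A limit superior is bounded below along the multiples of [k], where the logarithm of the count
     divided by the time is exactly [ln 3 / k]. *)
  exists (k * n.+1)%N; last reflexivity.
  by rewrite /= (leq_trans (leqnSn n))// leq_pmull.
have -> : ((ln 3 / k%:R)%:E =
    ((k * n.+1)%:R^-1)%:E * lne ((3 ^ n.+1)%:R : R)%:E :> \bar R)%E.
  rewrite lne_EFin ?ltr0n ?expn_gt0// -EFinM natrX lnXn// natrM invfM.
  have kR : (k%:R : R) != 0 by rewrite pnatr_eq0 -lt0n.
  have nR : (n.+1%:R : R) != 0 by rewrite pnatr_eq0.
  rewrite -(mulr_natr (ln _) n.+1); move: nR; set m := n.+1%:R => m0.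
  congr EFin; field; by rewrite kR nat1r pnatr_eq0.
have cn0 : (0 <= ((k * n.+1)%:R^-1 : R)%:E)%E by rewrite lee_fin invr_ge0.
apply: (lee_wpmul2l cn0).
rewrite lee_lne//.
- by rewrite in_itv/= lee_fin ler0n leey.
- rewrite in_itv/= leey andbT; apply: le_trans (Heps n.+1).
  by rewrite lee_fin ler0n.
Unshelve. all: by end_near. Qed.

End horseshoe_entropy.

(** An injective path on a compact interval is an embedding: parameters at distance at least [r]
    from [u z0] have a compact image, which misses a neighbourhood of [p z0]. *)
Lemma lift_continuous (R : realType) (T : topologicalType) (h p : R -> T)
    (u : R -> R) : hausdorff_space T -> continuous h -> continuous p ->
  (forall s t, 0 <= s <= 1 -> 0 <= t <= 1 -> h s = h t -> s = t) ->
  (forall z, 0 <= u z <= 1 /\ h (u z) = p z) -> continuous u.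
Proof.
move=> hT ch cp hinj hu z0 A /nbhs_ballP[r /= r0 rA].
pose K := `[0, 1] `&` ~` ball (u z0) r.
have cK : compact K.
  apply: compact_closedI; first exact: segment_compact.
  by apply: open_closedC; exact: ball_open.
have nK : nbhs (p z0) (~` (h @` K)).
  apply: open_nbhs_nbhs; split.
    by apply: closed_openC; apply: compact_closed => //; exact: compact_image.
  move=> [t [/=]]; rewrite in_itv/= => t01 tr; rewrite -(hu z0).2 => /hinj tu.
  by apply: tr; rewrite tu ?(hu z0).1//; exact: ballxx.
have npK : nbhs z0 (p @^-1` (~` (h @` K))) := cp z0 _ nK.
apply: (filterS _ npK) => z /= nz; apply: rA.
apply: contrapT => nball; apply: nz; exists (u z); last exact: (hu z).2.
by split => //=; rewrite in_itv/= (hu z).1.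
Qed.

Section end_entropy.
Context {R : realType} {G : metricType R} {E : finType} {g : E -> R -> G}.
Context {f : G -> G} (Gg : arcs setT g) (cf : continuous f) (mf : mixing f).
Context {s : E} {k : nat} (k0 : (0 < k)%N).
Context (side : forall d, 0 < d < 1 -> exists2 c, 0 < c & forall z, 0 < z < c ->
  exists2 y, 0 < y < d & iter k f (g s z) = g s y).
Context (preimage : forall d, 0 < d -> exists2 c, 0 < c &
  forall y p, 0 < y < c -> iter k f p = g s y -> exists2 z, 0 < z < d & p = g s z).

(** Mixing controls all late times, in particular the multiple [N * k], so invariance under the
    [k]-th iterate is enough. *)
Lemma invariant_meets (Y : set G) a b c d : (forall p, Y p -> Y (iter k f p)) ->
  0 <= a -> a < b -> b <= 1 -> 0 <= c -> c < d -> d <= 1 ->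
  g s @` `]a, b[ `<=` Y -> exists2 t, c < t < d & Y (g s t).
Proof.
move=> FY a0 ab b1 c0 cd d1 UY.
have [N N0 HN] := mf (arc_open s Gg a0 b1) (arc_open s Gg c0 d1)
  (arc_open_neq0 (g := g) s ab) (arc_open_neq0 (g := g) s cd).
have [|x [[y Uy yx] [t /= + tx]]] := HN (N * k)%N; first by rewrite leq_pmulr.
rewrite in_itv/= => tcd; exists t => //; rewrite tx -yx iterM.
by elim: N {N0 HN yx} => [|N IHN]; [exact: UY|exact: FY].
Qed.

Lemma end_lift : exists (c : R) (phi : R -> R), [/\ 0 < c < 1, continuous phi, phi 0 = 0,
  forall z, 0 < z <= c -> 0 < phi z < 1 &
  forall z, 0 <= z <= c -> iter k f (g s z) = g s (phi z)].
Proof.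
have cF := iter_continuous (n := k) cf.
have fix0 : iter k f (g s 0) = g s 0.
  (* The limit argument for ends is applied to the iterate, which sends the end [s] to itself. *)
  apply: (follows_start (f := iter k f) Gg cF) => c c0.
  have [|c' c'0 Hc'] := side (d := Num.min c (1 / 2)).
    by rewrite lt_min c0 gt_min; apply/andP; split; [|apply/orP; right]; lra.
  have : Num.min c c' / 2 < Num.min c c' by rewrite ltr_pdivrMr// ltr_pMr ?lt_min ?c0 ?ltr1n.
  have m0 : 0 < Num.min c c' / 2 by rewrite divr_gt0// lt_min c0.
  rewrite lt_min => /andP[mc mc'].
  have [|y /andP[y0 +] zy] := Hc' (Num.min c c' / 2); first by rewrite m0.
  by rewrite lt_min => /andP[yc _]; exists (Num.min c c' / 2), y; rewrite m0 y0.
have h01 : 0 < (1 / 2 : R) < 1 by lra.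
have [c0 c00 Hc0] := side h01.
pose c := Num.min c0 1 / 2.
have cpos : 0 < c by rewrite divr_gt0// lt_min c00 ltr01.
have [cc0 c1] : c < c0 /\ c < 1.
  have : c < Num.min c0 1 by rewrite /c ltr_pdivrMr// ltr_pMr ?lt_min ?c00 ?ltr01 ?ltr1n.
  by rewrite lt_min => /andP[].
have /choice[phi phiP] : forall z, exists y, 0 <= y <= 1 /\
    g s y = iter k f (g s (clamp 0 c z)).
  move=> z; have /andP[z0 zc] := clamp_itv z (ltW cpos).
  have [->|zn0] := eqVneq (clamp 0 c z) 0; first by exists 0; rewrite lexx ler01 fix0.
  have [|y /andP[y0 y1] yz] := Hc0 (clamp 0 c z).
    by rewrite lt_neqAle eq_sym zn0 z0 (le_lt_trans zc cc0).
  by exists y; rewrite yz; split => //; apply/andP; split; lra.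
have phiE z : 0 <= z <= c -> iter k f (g s z) = g s (phi z).
  by move=> zc; rewrite (phiP z).2 clampK.
exists c, phi; split => //.
- by rewrite cpos.
- apply: (lift_continuous (p := fun z => iter k f (g s (clamp 0 c z)))
    (@metric_hausdorff R G) (arc_cont Gg s)) => //.
    move=> z; apply: (@continuous_comp _ _ _ (clamp 0 c) (iter k f \o g s)).
      exact: clamp_continuous.
    by apply: continuous_comp; [exact: (arc_cont Gg)|exact: cF].
  by move=> x y; exact: (arc_inj Gg).
- apply: (arc_inj Gg (e := s)); rewrite ?(phiP 0).1 ?lexx ?ler01//.
  by rewrite -phiE ?fix0// lexx ltW.
- move=> z /andP[z0 zc]; have [|y /andP[y0 y1] yz] := Hc0 z.
    by rewrite z0 (le_lt_trans zc).
  suff -> : phi z = y by apply/andP; split; lra.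
  apply: (arc_inj Gg (e := s)); first exact: (phiP z).1.
    by apply/andP; split; lra.
  by rewrite -yz phiE// zc ltW.
Qed.

Lemma end_entropy : ((ln 3 / k%:R)%:E <= topological_entropy f)%E.
Proof.
have [d [phi [/andP[d0 d1] cphi phi0 phipos phiE]]] := end_lift.
have [c' c'0 Hc'] := preimage d0.
pose c := Num.min c' d; have c0 : 0 < c by rewrite lt_min c'0.
have cd : c <= d by rewrite ge_min lexx orbT.
have cc' : c <= c' by rewrite ge_min lexx.
have inj := @arc_inj _ _ _ _ _ Gg s.
(* Without such a jump, the subarc up to [x] would be invariant under the iterate and never reach
   the rest of the arc. *)
have up x : 0 < x < c -> exists z, 0 < z <= x /\ x < phi z.
  move=> /andP[x0 xc]; apply: contrapT => /forallNP H.
  have [||||||||t /andP[xt t1] [w /=]] := @invariant_meets (g s @` `]0, x]) 0 x x 1.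
  - move=> _ [z /= + <-]; rewrite in_itv/= => /andP[z0 zx].
    have /andP[pz0 pz1] : 0 < phi z < 1 by apply: phipos; rewrite z0; lra.
    exists (phi z); last by rewrite phiE// ltW//=; lra.
    by rewrite /= in_itv/= pz0 leNgt; apply/negP => xz; apply: (H z); rewrite z0.
  - exact: lexx.
  - exact: x0.
  - lra.
  - exact: ltW.
  - lra.
  - exact: lexx.
  - move=> _ [z /= + <-]; rewrite in_itv/= => /andP[z0 zx]; exists z => //=.
    by rewrite in_itv/= z0 ltW.
  rewrite in_itv/= => /andP[w0 wx] /inj wt; have : w = t by apply: wt; apply/andP; split; lra.
  lra.
(* Without such a drop, the complement of the subarc below [x] would be invariant: a preimage of a
   point of that subarc lies on [s] before [d], hence before [x]. *)
have down x : 0 < x < c -> exists z, x <= z <= d /\ phi z < x.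
  move=> /andP[x0 xc]; apply: contrapT => /forallNP H.
  have [||||||||t tx] := @invariant_meets (~` (g s @` `]0, x[)) x 1 0 x.
  - move=> p nYp [y /=]; rewrite in_itv/= => /andP[y0 yx] /esym yp.
    have [|z /andP[z0 zd] pz] := Hc' y p _ yp; first by rewrite y0; lra.
    rewrite pz in nYp yp; have [xz|zx] := leP x z.
      have zd' : 0 <= z <= d by rewrite !ltW.
      have /andP[pz0 pz1] : 0 < phi z < 1 by apply: phipos; rewrite z0 ltW.
      apply: (H z); rewrite xz ltW//; split => //.
      suff -> : phi z = y by [].
      by apply: inj; rewrite -?phiE// ?yp//; apply/andP; split; lra.
    by apply: nYp; exists z => //=; rewrite in_itv/= z0.
  - exact: ltW.
  - lra.
  - exact: lexx.
  - exact: lexx.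
  - exact: x0.
  - lra.
  - move=> _ [z /= + <-] [y /=]; rewrite !in_itv/= => /andP[xz z1] /andP[y0 yx] /inj yz.
    have : y = z by apply: yz; apply/andP; split; lra.
    lra.
  by apply; exists t => //=; rewrite in_itv.
have [||||a [z [w [b [[a0 az zw wb bc] [phia phiz phiw phib]]]]]] :=
  low_high_low_high cphi phi0 (c := c) (d := d) => //.
- by rewrite c0.
- by move=> x /phipos /andP[].
have [l [r [lr_ab lr_lt lap]]] := strict_horseshoe cphi az zw wb phia phiz phiw phib.
have ab : a <= b by lra.
apply: (horseshoe_entropy k0 (arc_cont Gg s) ab _ _ lr_ab lr_lt lap).
- by move=> x y /andP[? ?] /andP[? ?]; apply: inj; apply/andP; split; lra.
- by move=> t /andP[? ?]; apply: phiE; apply/andP; split; lra.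
Qed.

End end_entropy.

(** * From arcs to simplicial complexes *)

(** The preimage of a closed set is, inside [A], a finite union of images of compact sets of
    parameters. This avoids any study of neighbourhoods of branching points. *)
Lemma piecewise_continuous (R : realType) (E : finType) (X Y : topologicalType)
    (A : set X) (p : E -> R -> X) (q : E -> R -> Y) (F : X -> Y) :
  hausdorff_space X -> (forall e, continuous (p e)) ->
  (forall e, continuous (q e)) ->
  A = \bigcup_(e in [set: E]) p e @` `[0, 1] ->
  (forall e t, 0 <= t <= 1 -> F (p e t) = q e t) -> {within A, continuous F}.
Proof.
move=> hX cp cq AE Fp; apply/continuous_closedP => Z cZ.
apply/closed_subspaceP.
exists (\bigcup_(e in [set: E]) p e @` (`[0, 1] `&` q e @^-1` Z)).
  apply: closed_bigcup; first exact: finite_finset.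
  move=> e _; apply: compact_closed => //; apply: compact_image => //.
  apply: compact_closedI; first exact: segment_compact.
  by apply: preimage_closed => // x _; exact: cq.
apply/seteqP; split => [x [[e _ [t [+ qt] <-]] Ax]|x [Fx]].
  rewrite /= in_itv/= => t01; split => //.
  by suff : Z (F (p e t)) by []; rewrite Fp.
rewrite AE => -[e _ [t t01 tx]]; split; last by exists e => //; exists t.
exists e => //; exists t => //; split => //.
by rewrite /= -Fp ?tx//; move: t01; rewrite /= in_itv.
Qed.

Section realization.
Context {R : realType} {G : metricType R} {A : set G} {E : finType}.
Context {g : E -> R -> G} (Ag : arcs A g) (e0 : E).

(* Each arc is subdivided at its midpoint, so that arcs with the same ends do
   not give the same simplex. The vertices are the ends of arcs, one
   representative for each point, and the midpoints. *)
Let V := ((E * bool) + E)%type.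
Let n := #|{: V}|.

Definition arc_end (x : E * bool) : G := g x.1 (if x.2 then 1 else 0).

Definition arc_end_repr (x : E * bool) : E * bool :=
  odflt x [pick y | arc_end y == arc_end x].

Lemma arc_end_reprK x : arc_end (arc_end_repr x) = arc_end x.
Proof. by rewrite /arc_end_repr; case: pickP => [y /eqP|]. Qed.

Lemma arc_end_repr_eq x y : arc_end x = arc_end y ->
  arc_end_repr x = arc_end_repr y.
Proof.
rewrite /arc_end_repr => ->; case: pickP => // /(_ y).
by rewrite eqxx.
Qed.

Definition end_vertex x : 'I_n := enum_rank (inl (arc_end_repr x) : V).
Definition mid_vertex e : 'I_n := enum_rank (inr e : V).

Lemma end_vertex_eq x y : (end_vertex x == end_vertex y) = (arc_end x == arc_end y).
Proof.
apply/eqP/eqP => [/enum_rank_inj[xy]|/arc_end_repr_eq xy]; last by rewrite /end_vertex xy.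
by rewrite -arc_end_reprK xy arc_end_reprK.
Qed.

Lemma end_mid_vertex x e : (end_vertex x == mid_vertex e) = false.
Proof. by apply/eqP => /enum_rank_inj. Qed.

Lemma mid_vertex_eq e e' : (mid_vertex e == mid_vertex e') = (e == e').
Proof. by apply/eqP/eqP => [/enum_rank_inj[]|->]. Qed.

Lemma end_vertex_neq e : (end_vertex (e, false) == end_vertex (e, true)) = false.
Proof. by rewrite end_vertex_eq; apply/eqP; exact: (arc_ends Ag). Qed.

(** Barycentric coordinates on the broken line that starts at one end vertex, passes the midpoint
    vertex at [t = 1 / 2] and stops at the other end vertex. *)
Definition realization (e : E) (t : R) : 'rV[R]_n :=
  \row_l (Num.max 0 (1 - 2 * t) * (l == end_vertex (e, false))%:R
        + Num.max 0 (2 * t - 1) * (l == end_vertex (e, true))%:R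
        + Num.min (2 * t) (2 - 2 * t) * (l == mid_vertex e)%:R).

Lemma realization_mid e e' t : realization e t 0 (mid_vertex e') =
  Num.min (2 * t) (2 - 2 * t) * (e' == e)%:R.
Proof. by rewrite mxE mid_vertex_eq !(eq_sym (mid_vertex e')) !end_mid_vertex !mulr0 !add0r. Qed.

Lemma realization_end e b t : realization e t 0 (end_vertex (e, b)) =
  if b then Num.max 0 (2 * t - 1) else Num.max 0 (1 - 2 * t).
Proof.
rewrite mxE end_mid_vertex; case: b; rewrite eqxx ?end_vertex_neq.
  by rewrite eq_sym end_vertex_neq !mulr0 add0r addr0 mulr1.
by rewrite !mulr0 !addr0 mulr1.
Qed.

Lemma realization_bool e (b : bool) :
  realization e (if b then 1 else 0) = delta_mx 0 (end_vertex (e, b)).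
Proof.
apply/rowP => l; rewrite !mxE/=; case: b.
  have -> : Num.max 0 (1 - 2 * 1) = 0 :> R by rewrite max_l//; lra.
  have -> : Num.max 0 (2 * 1 - 1) = 1 :> R by rewrite max_r; lra.
  have -> : Num.min (2 * 1) (2 - 2 * 1) = 0 :> R by rewrite min_r; lra.
  by rewrite !mul0r mul1r add0r addr0.
have -> : Num.max 0 (1 - 2 * 0) = 1 :> R by rewrite max_r; lra.
have -> : Num.max 0 (2 * 0 - 1) = 0 :> R by rewrite max_l//; lra.
have -> : Num.min (2 * 0) (2 - 2 * 0) = 0 :> R by rewrite min_l; lra.
by rewrite !mul0r mul1r !addr0.
Qed.

Lemma realization_continuous e : continuous (realization e).
Proof.
apply: row_continuous => l; rewrite /realization; under eq_fun do rewrite mxE.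
have aff (a b : R) : continuous (fun t : R => a + b * t).
  by move=> t; apply: cvgD; [exact: cvg_cst|apply: cvgMr; exact: cvg_id].
have mulc (u : R -> R) (c : R) : continuous u -> continuous (fun t => u t * c).
  by move=> cu t; apply: cvgMl; exact: cu.
have addc (u v : R -> R) : continuous u -> continuous v ->
    continuous (fun t => u t + v t).
  by move=> cu cv t; apply: cvgD; [exact: cu|exact: cv].
have cst (r : R) : continuous (fun _ : R => r) by move=> t; exact: cvg_cst.
apply: (addc); [apply: (addc)|]; apply: (mulc).
- apply: (max_fun_continuous (@cst 0)).
  rewrite (_ : (fun t : R => 1 - 2 * t) = fun t => 1 + -2 * t); first exact: (aff).
  by apply/funext => t; lra.
- apply: (max_fun_continuous (@cst 0)).
  rewrite (_ : (fun t : R => 2 * t - 1) = fun t => -1 + 2 * t); first exact: (aff).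
  by apply/funext => t; lra.
- apply: min_fun_continuous.
    by move=> t; apply: cvgMr; exact: cvg_id.
  rewrite (_ : (fun t : R => 2 - 2 * t) = fun t => 2 + -2 * t); first exact: (aff).
  by apply/funext => t; lra.
Qed.

Lemma interior_or_end (t : R) : 0 <= t <= 1 ->
  0 < t < 1 \/ exists b : bool, t = if b then 1 else 0.
Proof.
move=> /andP[t0 t1].
have [->|tn0] := eqVneq t 0; first by right; exists false.
have [->|tn1] := eqVneq t 1; first by right; exists true.
by left; rewrite !lt_neqAle t0 t1 tn1 eq_sym tn0.
Qed.

(** Arcs and broken lines are glued in the same way, so matching parameters is well defined in both
    directions. For interior points the positive midpoint coordinate names the arc, and the two end
    coordinates then give [t]. *)
Lemma realization_eq e e' t t' : 0 <= t <= 1 -> 0 <= t' <= 1 ->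
  g e t = g e' t' <-> realization e t = realization e' t'.
Proof.
have half d d' s s' : 0 < s < 1 -> 0 <= s' <= 1 ->
    realization d s = realization d' s' -> d = d' /\ s = s'.
  move=> s01 s'01 /rowP H; have dd' : d = d'.
    apply/eqP/contraT => /negbTE dd'; have := H (mid_vertex d).
    rewrite !realization_mid dd' eqxx mulr0 mulr1 /Num.min.
    by case: ifP; lra.
  split => //; subst d'; have := H (end_vertex (d, false)); have := H (end_vertex (d, true)).
  rewrite !realization_end !maxEle; do !case: ifP; lra.
move=> t01 t'01; case: (interior_or_end t01) => [tin|[b tb]].
  split=> [/(arc_disj Ag tin t'01)|/half-/(_ tin t'01)] [-> ->] //.
case: (interior_or_end t'01) => [t'in|[b' tb']].
  split=> /esym; first by move=> /(arc_disj Ag t'in t01)[-> ->].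
  by move=> /half-/(_ t'in t01)[-> ->].
rewrite tb tb' !realization_bool.
have := end_vertex_eq (e, b) (e', b'); rewrite /arc_end/= => H.
split=> [/eqP|/rowP/(_ (end_vertex (e, b)))]; first by rewrite -H => /eqP ->.
rewrite !mxE !eqxx/= H => /eqP; rewrite eqr_nat.
by case: (g e _ =P g e' _).
Qed.

Definition arc_complex : {set {set 'I_n}} :=
  [set S : {set 'I_n} | (S != finset.set0) && [exists e, exists b,
     S \subset [set end_vertex (e, b); mid_vertex e]%SET]]%SET.

Lemma arc_complexP (S : {set 'I_n}) : reflect (S != finset.set0 /\ exists e b,
  S \subset [set end_vertex (e, b); mid_vertex e]%SET) (S \in arc_complex).
Proof.
rewrite inE; apply: (iffP andP) => -[S0].
  by move=> /existsP[e /existsP[b Seb]]; split => //; exists e, b.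
by move=> [e [b Seb]]; split => //; apply/existsP; exists e; apply/existsP; exists b.
Qed.

Lemma arc_complex_simplicial : simplicial_complex arc_complex.
Proof.
split; first by rewrite inE eqxx.
move=> S T /arc_complexP[_ [e [b Seb]]] TS T0; apply/arc_complexP; split => //.
by exists e, b; exact: fintype.subset_trans TS Seb.
Qed.

Lemma arc_complex_dim : complex_dim arc_complex = 1%N.
Proof.
apply/eqP; rewrite eqn_leq; apply/andP; split.
  apply/bigmax_leqP => S /arc_complexP[_ [e [b /subset_leq_card]]].
  rewrite cards2 => S2; rewrite -subn1 leq_subLR (leq_trans S2)//.
  by case: (_ != _).
pose S := [set end_vertex (e0, true); mid_vertex e0]%SET.
have SK : S \in arc_complex.
  apply/arc_complexP; split; last by exists e0, true.
  by apply/set0Pn; exists (mid_vertex e0); rewrite !inE eqxx orbT.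
apply: leq_trans (@leq_bigmax_cond _ (mem arc_complex) (fun S => #|S|.-1) _ SK).
by rewrite cards2 end_mid_vertex.
Qed.

Lemma realization_carrier e t : 0 <= t <= 1 ->
  @carrier R n arc_complex (realization e t).
Proof.
move=> /andP[t0 t1].
have sum1 : \sum_i realization e t 0 i = 1.
  under eq_bigr do rewrite mxE.
  rewrite 2!big_split/= -!mulr_sumr.
  have S1 (j : 'I_n) : \sum_i ((i == j)%:R : R) = 1.
    by rewrite (bigD1 j)//= eqxx big1 ?addr0// => i /negbTE ->.
  by rewrite !S1 !mulr1 !maxEle minEle; do !case: ifP; lra.
split => //.
  move=> i; rewrite mxE; apply: addr_ge0; [apply: addr_ge0|]; apply: mulr_ge0; rewrite ?ler0n//.
  - by rewrite le_max lexx.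
  - by rewrite le_max lexx.
  - by rewrite le_min; lra.
apply/arc_complexP; split.
  apply: contraTneq isT => S0; move: sum1; rewrite big1 => [/eqP|i _].
    by rewrite eq_sym oner_eq0.
  by apply/eqP; have := finset.in_set0 i; rewrite -S0 inE => /negbFE.
exists e, (1 / 2 < t); apply/fintype.subsetP => i; rewrite !inE.
apply: contraR; rewrite negb_or mxE => /andP[/negbTE ib /negbTE ->].
rewrite mulr0 addr0; case: ltP ib => th ->; rewrite mulr0 ?addr0 ?add0r.
  by rewrite (_ : Num.max 0 (1 - 2 * t) = 0) ?mul0r// maxEle; case: ifP; lra.
by rewrite (_ : Num.max 0 (2 * t - 1) = 0) ?mul0r// maxEle; case: ifP; lra.
Qed.

Lemma carrier_realization x : @carrier R n arc_complex x ->
  exists e t, 0 <= t <= 1 /\ x = realization e t.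
Proof.
move=> [x0 x1 /arc_complexP[_ [e [b /fintype.subsetP sub]]]].
have xl l : l != end_vertex (e, b) -> l != mid_vertex e -> x 0 l = 0.
  move=> l1 l2; apply/eqP; apply: contraT => xl.
  by have := sub l; rewrite !inE xl (negbTE l1) (negbTE l2) => /(_ isT).
have xem : x 0 (end_vertex (e, b)) + x 0 (mid_vertex e) = 1.
  move: x1; rewrite (bigD1 (end_vertex (e, b)))//= (bigD1 (mid_vertex e))/=; last first.
    by rewrite eq_sym end_mid_vertex.
  by rewrite big1 ?addr0// => l /andP[]; exact: xl.
have xe0 := x0 (end_vertex (e, b)); have xm0 := x0 (mid_vertex e).
exists e, (if b then 1 - x 0 (mid_vertex e) / 2 else x 0 (mid_vertex e) / 2).
split; first by case: (b) xem xe0 => xem xe0; lra.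
apply/rowP => l; rewrite mxE.
have [->|le] := eqVneq l (end_vertex (e, b)).
  rewrite end_mid_vertex mulr0 addr0; case: (b) xem xe0 => xem xe0.
    rewrite [in X in _ * X%:R + _]eq_sym end_vertex_neq eqxx mulr0 add0r mulr1.
    by rewrite maxEle; case: ifP; lra.
  by rewrite end_vertex_neq eqxx mulr0 addr0 mulr1 maxEle; case: ifP; lra.
have [->|lm] := eqVneq l (mid_vertex e).
  rewrite !(eq_sym (mid_vertex e)) !end_mid_vertex !mulr0 !add0r mulr1 minEle.
  by case: (b) xem xe0 => xem xe0; case: ifP; lra.
rewrite xl// mulr0 addr0; case: (b) le xem xe0 => /negbTE -> xem xe0; rewrite mulr0 ?addr0 ?add0r.
  by rewrite (_ : Num.max 0 _ = 0) ?mul0r// maxEle; case: ifP; lra.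
by rewrite (_ : Num.max 0 _ = 0) ?mul0r// maxEle; case: ifP; lra.
Qed.

Lemma arcs_homeomorphic : homeomorphic A (@carrier R n arc_complex).
Proof.
have /choice[F FE] : forall y, exists z, forall e t, 0 <= t <= 1 -> y = g e t ->
    z = realization e t.
  move=> y; have [Ay|nAy] := pselect (A y); last first.
    by exists 0 => e t t01 yt; case: nAy; rewrite yt; exact: (arc_sub Ag).
  have [e [t [t01 yt]]] := arc_coverP Ag Ay; exists (realization e t) => e' t' t'01 yt'.
  by apply/realization_eq => //; rewrite -yt.
have /choice[H HE] : forall z, exists y, forall e t, 0 <= t <= 1 -> z = realization e t ->
    y = g e t.
  move=> z; have [[e [t [t01 zt]]]|nz] := pselect (exists e t, 0 <= t <= 1 /\ z = realization e t).
    by exists (g e t) => e' t' t'01 zt'; apply/realization_eq => //; rewrite -zt.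
  by exists (g e0 0) => e t t01 zt; case: nz; exists e, t.
have Fg e t : 0 <= t <= 1 -> F (g e t) = realization e t by move=> t01; exact: FE.
have Hr e t : 0 <= t <= 1 -> H (realization e t) = g e t by move=> t01; exact: HE.
exists F, H; split.
- apply: (piecewise_continuous (@metric_hausdorff R G) (arc_cont Ag)
    realization_continuous (arc_cover Ag) Fg).
- apply: (piecewise_continuous _ realization_continuous (arc_cont Ag) _ Hr).
    exact: norm_hausdorff.
  apply/seteqP; split => [x /carrier_realization[e [t [t01 ->]]]|_ [e _ [t /= + <-]]].
    by exists e => //; exists t => //=; rewrite in_itv.
  by rewrite in_itv/=; exact: realization_carrier.
- move=> _ [y /(arc_coverP Ag)[e [t [t01 ->]]] <-].
  by rewrite Fg//; exact: realization_carrier.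
- move=> _ [x /carrier_realization[e [t [t01 ->]]] <-].
  by rewrite Hr//; exact: (arc_sub Ag).
- split=> [y /(arc_coverP Ag)|x /carrier_realization] [e [t [t01 ->]]].
    by rewrite Fg// Hr.
  by rewrite Hr// Fg.
Qed.

Lemma arcs_is_graph : compact A -> connected A -> is_graph A.
Proof.
move=> kA cA; split => //; exists n, arc_complex.
by split; [exact: arc_complex_simplicial|exact: arc_complex_dim|exact: arcs_homeomorphic].
Qed.

End realization.

(** * Disconnecting numbers *)

Lemma pigeonhole3 (E : finType) (T : Type) (c : T -> E) (s : seq T) :
  (#|E| * 2 < size s)%N -> exists e, (2 < count (fun x => c x == e) s)%N.
Proof.
move=> ns; apply: contrapT => /forallNP H.
have : (\sum_e count (fun x => c x == e) s <= #|E| * 2)%N.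
  rewrite -sum_nat_const; apply: leq_sum => e _.
  by rewrite leqNgt; apply/negP; exact: H.
suff -> : (\sum_e count (fun x => c x == e) s = size s)%N by rewrite leqNgt ns.
elim: {ns H} s => [|x s IHs] /=; first by rewrite big1.
rewrite big_split/= IHs (bigD1 (c x))//= eqxx big1 ?addn0// => e /negbTE.
by rewrite eq_sym => ->.
Qed.

Lemma three_increasing (R : realType) (s : seq R) : uniq s -> (2 < size s)%N ->
  exists x y z, [/\ x < y, y < z & [/\ x \in s, y \in s & z \in s]].
Proof.
rewrite -sort_lt_sorted -(size_sort <=%O s) => so si.
have ms : sort <=%O s =i s by exact: mem_sort.
case: (sort <=%O s) so si ms => [|x [|y [|z u]]] //= /and3P[xy yz _] _ ms.
by exists x, y, z; split => //; split; rewrite -ms !inE eqxx ?orbT.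
Qed.

Section arcs_disconnecting.
Context {R : realType} {G : metricType R} {A : set G} {E : finType}.
Context {g : E -> R -> G} (Ag : arcs A g).

(** Inside a finite set, a connected closed subarc would be a single point, against injectivity. *)
Lemma arc_avoids_finite e a b (D : set G) : finite_set D -> 0 <= a -> a < b ->
  b <= 1 -> exists2 t, a < t < b & ~ D (g e t).
Proof.
move=> fD a0 ab b1; apply: contrapT => H.
pose u := (2 * a + b) / 3; pose v := (a + 2 * b) / 3.
have [au uv vb] : [/\ a < u, u < v & v < b] by rewrite /u /v; split; lra.
pose C := g e @` `[u, v].
have Cu : C (g e u) by exists u => //=; rewrite in_itv/= lexx ltW.
have Cv : C (g e v) by exists v => //=; rewrite in_itv/= lexx ltW.
have CD : C `<=` D.
  move=> _ [t /= + <-]; rewrite in_itv/= => /andP[ut tv].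
  by apply: contrapT => nD; apply: H; exists t => //; apply/andP; split; lra.
have CE : C = [set g e u].
  apply: connected_cofinite.
  - exact: metric_hausdorff.
  - exact: path_connected (arc_cont Ag e).
  - apply: accessible_closed_set1; exact/hausdorff_accessible/metric_hausdorff.
  - by move=> _ ->.
  - by exists (g e u).
  - by apply: sub_finite_set fD => x [/CD].
move: Cv; rewrite CE => /(arc_inj Ag) vu.
have : v = u by apply: vu; apply/andP; split; lra.
lra.
Qed.

(* Of 2 |E| + 1 points, three lie on the same arc; they cut off the two open
   subarcs between them from each other. *)
Lemma arcs_disconnecting : exists n, disconnecting A n.
Proof.
exists (#|E| * 2).+1; split => // D DA Dn cAD.
have fD : finite_set D by apply/finite_setP; exists (#|E| * 2).+1.
pose s := finmap.enum_fset (fset_set D).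
have ss : size s = (#|E| * 2).+1 by exact: card_fset_set.
have sD x : x \in s -> D x by rewrite (in_fset_set fD) => /set_mem.
have [q sq q01] : exists2 q : seq (E * R), s = [seq g p.1 p.2 | p <- q] &
    forall p, p \in q -> 0 <= p.2 <= 1.
  elim: (s) sD => [|x u IHu] uD; first by exists [::].
  have [|q -> q01] := IHu; first by move=> y yu; apply: uD; rewrite inE yu orbT.
  have [e [t [t01 ->]]] := arc_coverP Ag (DA _ (uD x (mem_head _ _))).
  exists ((e, t) :: q) => // p; rewrite inE => /predU1P[->//|]; exact: q01.
have qu : uniq q by apply: (@map_uniq _ _ (fun p => g p.1 p.2)); rewrite -sq finmap.fset_uniq.
have [|e e3] := @pigeonhole3 E _ fst q.
  by rewrite -(size_map (fun p => g p.1 p.2)) -sq ss.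
pose ts := [seq p.2 | p <- q & p.1 == e].
have tsu : uniq ts.
  rewrite map_inj_in_uniq ?filter_uniq// => -[e1 t1] [e2 t2].
  by rewrite !mem_filter/= => /andP[/eqP-> _] /andP[/eqP-> _] ->.
have tsD t : t \in ts -> 0 <= t <= 1 /\ D (g e t).
  move=> /mapP[[e' t']]; rewrite mem_filter/= => /andP[/eqP-> tq] ->.
  split; first exact: q01 tq.
  by apply: sD; rewrite sq; apply/mapP; exists (e, t').
have [|x [y [z [xy yz [/tsD[x01 Dx] /tsD[y01 Dy] /tsD[z01 Dz]]]]]] := three_increasing tsu.
  by rewrite size_map size_filter.
case/andP: x01 y01 z01 => x0 x1 /andP[y0 y1] /andP[z0 z1].
have [u /andP[xu uy] nDu] := arc_avoids_finite e fD x0 xy y1.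
have [v /andP[yv vz] nDv] := arc_avoids_finite e fD y0 yz z1.
have in01 w : x < w -> w < z -> 0 <= w <= 1 by move=> ? ?; apply/andP; split; lra.
have inA w : 0 <= w <= 1 -> ~ D (g e w) -> (A `\` D) (g e w).
  by move=> w01 nD; split => //; exact: (arc_sub Ag).
have u01 : 0 <= u <= 1 by apply: in01; lra.
have v01 : 0 <= v <= 1 by apply: in01; lra.
have xuy : x < u < y by rewrite xu.
have := @arc_separation _ _ _ _ _ Ag e x y u (A `\` D) cAD (@subDsetl _ _ _)
  x0 y1 xuy (inA _ u01 nDu).
move=> /(_ (fun h => h.2 Dx) (fun h => h.2 Dy) _ (inA _ v01 nDv))[w /=].
rewrite in_itv/= => /andP[xw wy] /(arc_inj Ag) wv.
by have := wv (in01 _ xw (lt_trans wy yz)) v01; lra.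
Qed.

(* The start of an arc that no other arc touches has arbitrarily small connected
   punctured neighbourhoods. *)
Lemma connected_remove_free_end e (C : set G) : connected C -> C `<=` A ->
  (forall e' t, 0 <= t <= 1 -> g e' t = g e 0 -> e' = e) ->
  (forall t, 0 <= t < 1 -> C (g e t)) -> connected (C `\ g e 0).
Proof.
move=> cC CA free Ce; apply/connectedP => F [F0 CF sepF].
pose J := g e @` `]0, 1[.
have cJ : connected J.
  apply: connected_continuous_connected; last exact/continuous_subspaceT/(arc_cont Ag).
  exact/connected_intervalP/interval_is_interval.
have JC : J `<=` C `\ g e 0.
  move=> _ [t /= + <-]; rewrite in_itv/= => /andP[t0 t1]; split.
    by apply: Ce; rewrite t1 ltW.
  move=> /= /(arc_inj Ag) t00; have : t = 0 by apply: t00; rewrite ?lexx ?ler01// !ltW.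
  by move=> t00'; rewrite t00' ltxx in t0.
have [b JF] : exists b, J `<=` F b.
  have [||] := connected_subset sepF _ cJ; first by rewrite -CF.
    by exists false.
  by exists true.
have {}sepF : separated (F b) (F (~~ b)).
  by case: (b) sepF => //; rewrite separatedC.
have {}CF : C `\ g e 0 = F b `|` F (~~ b) by rewrite CF; case: (b); rewrite // setUC.
have Ce0 : C (g e 0) by apply: Ce; rewrite lexx ltr01.
(* A closed set that avoids the removed point and contains the part of the splitting without [J].
   The removed point can therefore be put back on the side of [J], which would separate [C]. *)
pose Q := (\bigcup_(e' in [set e' | e' != e]) g e' @` `[0, 1]) `|` g e @` `[1, 1].
have cQ : closed Q.
  apply: closedU; last exact: (arc_closed Ag).
  apply: closed_bigcup; first exact: finite_finset.
  by move=> e' _; exact: (arc_closed Ag).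
have nQ : ~ Q (g e 0).
  case=> [[e' /= e'e [t /=]]|[t /=]]; rewrite in_itv/= => t01.
    by move=> /free-/(_ t01) ee'; rewrite ee' eqxx in e'e.
  have -> : t = 1 by apply/eqP; rewrite eq_le andbC.
  by move=> /esym; exact: (arc_ends Ag).
have FQ : F (~~ b) `<=` Q.
  move=> x Fx; have [Cx xe0] : (C `\ g e 0) x by rewrite CF; right.
  have [e' [t [t01 xt]]] := arc_coverP Ag (CA _ Cx).
  have [ee'|e'e] := eqVneq e' e; last by left; exists e' => //; exists t => //=; rewrite in_itv.
  right; exists t; last by rewrite xt ee'.
  have [tin|[[] tb]] := interior_or_end t01.
  - have Jx : J x by exists t => //; rewrite xt ee'.
    have /seteqP[/(_ x)[]] := separated_disjoint sepF.
    by split => //; exact: JF.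
  - by rewrite tb /= in_itv/= lexx.
  - by case: xe0; rewrite /= xt ee' tb.
have F'0 : F (~~ b) !=set0 by exact: F0.
have sep' : separated (F b `|` [set g e 0]) (F (~~ b)).
  have cl0 : closed [set g e 0].
    by apply: accessible_closed_set1; exact/hausdorff_accessible/metric_hausdorff.
  split; apply/seteqP; split => // x.
    rewrite closureU => -[[clF|clx] Fx].
      by have /seteqP[/(_ x)[]] := sepF.1.
    by move: clx Fx; rewrite -((closure_id _).1 cl0) => -> /FQ/nQ.
  move=> [[Fx|/= ->] clx].
    by have /seteqP[/(_ x)[]] := sepF.2.
  by apply: nQ; rewrite ((closure_id _).1 cQ); exact: closureS clx.
move/connectedP : cC => /(_ (fun b' => if b' then F (~~ b) else F b `|` [set g e 0])).
apply; split => //.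
- by case=> //; exists (g e 0); right.
- by rewrite /= setUAC -CF setUC setDUK// => _ ->.
Qed.

End arcs_disconnecting.
Lemma uniq_seq_card (T : choiceType) (s : seq T) :
  uniq s -> ([set` s] #= `I_(size s))%card.
Proof.
elim: s => [_|x s IHs /= /andP[xs us]].
  by rewrite II0 card_eq0; apply/eqP/seteqP; split.
apply/eq_cardSP; exists x; first by rewrite /= mem_head.
suff -> : [set` x :: s] `\ x = [set` s] by exact: IHs.
apply/seteqP; split => [y /= []|y /= ys].
  by rewrite inE => /predU1P[->|].
by rewrite inE ys orbT; split => // yx; rewrite -yx ys in xs.
Qed.

(** Nonemptiness gives a least element; otherwise the default 0 would make the claim false. *)
Lemma disconnecting_number_gt (T : topologicalType) (A : set T) n :
  (exists m, disconnecting A m) ->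
  (forall m, (0 < m <= n)%N ->
     exists D, [/\ D `<=` A, (D #= `I_m)%card & connected (A `\` D)]) ->
  (n < disconnecting_number A)%N.
Proof.
move=> [m0 dm0] H; rewrite /disconnecting_number.
case: xgetP => [m _ [[m_gt0 dm] _]|/(_ _) none].
  rewrite ltnNge; apply/negP => mn.
  have [|D [DA Dm]] := H m; first by rewrite m_gt0.
  exact: dm.
have ex : exists m, `[< disconnecting A m >] by exists m0; exact/asboolP.
case: (none (ex_minn ex)); case: ex_minnP => m /asboolP dm min; split => // l dl.
by apply: min; exact/asboolP.
Qed.

(** A nonzero [Lambda G] is not the default, so it is a genuine upper bound. This spares a proof
    that the maximum is attained. *)
Lemma disconnecting_number_Lambda (R : realType) (G : metricType R) (A : set G) :
  is_graph A -> Lambda G <> 0%N -> (disconnecting_number A <= Lambda G)%N.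
Proof.
move=> gA; rewrite /Lambda.
case: xgetP => [m _ [_ ubm]|_ //] _.
by apply: ubm; exists A.
Qed.

Section free_ends.
Context {R : realType} {G : metricType R} {A : set G} {E : finType}.
Context {g : E -> R -> G} (Ag : arcs A g).

Definition free_end e := forall e' t, 0 <= t <= 1 -> g e' t = g e 0 -> e' = e.

(** The points are removed one at a time. The set left at each stage still contains the rest of
    every other free arc, which is what [connected_remove_free_end] asks of [C]. *)
Lemma connected_remove_free_ends (u : seq E) : uniq u -> connected A ->
  (forall e, e \in u -> free_end e) ->
  connected (A `\` [set` [seq g e 0 | e <- u]]).
Proof.
move=> + cA; elim: u => [_ _|e u IHu /= /andP[eu uu] free].
  by rewrite (_ : [set` _] = set0) ?setD0//; apply/seteqP; split.
have freeu e' : e' \in u -> free_end e' by move=> e'u; apply: free; rewrite inE e'u orbT.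
have -> : A `\` [set` g e 0 :: [seq g e' 0 | e' <- u]] =
    (A `\` [set` [seq g e' 0 | e' <- u]]) `\ g e 0.
  rewrite setDDl; congr (_ `\` _); apply/seteqP; split => x /=.
    by rewrite inE => /predU1P[->|?]; [right|left].
  by rewrite inE => -[->|->]; rewrite ?orbT ?eqxx.
apply: (connected_remove_free_end Ag); [exact: IHu|exact: subDsetl| |].
  by apply: free; rewrite mem_head.
move=> t /andP[t0 t1]; split.
  by apply: (arc_sub Ag); rewrite t0 ltW.
move=> /mapP[e' e'u get]; have ee' : e = e'.
  by apply: (freeu e' e'u e t) => //; rewrite t0 ltW.
by rewrite ee' e'u in eu.
Qed.

Lemma free_ends_disconnecting_number (F : {set E}) : connected A ->
  (forall e, e \in F -> free_end e) -> (#|F| < disconnecting_number A)%N.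
Proof.
move=> cA free; apply: disconnecting_number_gt.
  exact: (arcs_disconnecting Ag).
move=> m /andP[_ mF]; pose u := take m (enum F).
have sub e : e \in u -> e \in F by move=> /mem_take; rewrite mem_enum.
have su : size u = m by rewrite size_takel// -cardE.
have uu : uniq u by rewrite take_uniq// enum_uniq.
exists [set` [seq g e 0 | e <- u]]; split.
- by move=> x /= /mapP[e _ ->]; apply: (arc_sub Ag); rewrite lexx ler01.
- rewrite -su -(size_map (fun e => g e 0)); apply: uniq_seq_card.
  rewrite map_inj_in_uniq// => e e' eu e'u ee'.
  by apply: (free _ (sub _ e'u) _ 0) => //; rewrite lexx ler01.
- by apply: connected_remove_free_ends => // e /sub; exact: free.
Qed.

End free_ends.

Section trimmed_arcs.
Context {R : realType} {G : metricType R} {A : set G} {E : finType}.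
Context {g : E -> R -> G} (Ag : arcs A g) (l : E -> R).
Context (l01 : forall e, 0 <= l e < 1).

Definition trimmed_arc (e : E) (t : R) : G := g e (l e + t * (1 - l e)).

Lemma trimmed_arcs :
  arcs (\bigcup_(e in [set: E]) trimmed_arc e @` `[0, 1]) trimmed_arc.
Proof.
have lP e : 0 <= l e /\ 0 < 1 - l e by have /andP[? ?] := l01 e; split; lra.
have itv e t : 0 <= t <= 1 -> 0 <= l e + t * (1 - l e) <= 1.
  move=> /andP[t0 t1]; have [? l1] := lP e; have tl : t * (1 - l e) <= 1 - l e.
    by rewrite ler_piMl// ltW.
  have : 0 <= t * (1 - l e) by rewrite mulr_ge0// ltW.
  by move=> ?; apply/andP; split; lra.
have itvo e t : 0 < t < 1 -> 0 < l e + t * (1 - l e) < 1.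
  move=> /andP[t0 t1]; have [? l1] := lP e; have tl : t * (1 - l e) < 1 - l e.
    by rewrite gtr_pMl.
  have : 0 < t * (1 - l e) by rewrite mulr_gt0.
  by move=> ?; apply/andP; split; lra.
have inj e t t' : l e + t * (1 - l e) = l e + t' * (1 - l e) -> t = t'.
  by have [_ l1] := lP e; move=> /addrI/mulIf; apply; rewrite gt_eqF.
split=> //.
- move=> e x; apply: (@continuous_comp _ _ _ (fun t : R => l e + t * (1 - l e))); last exact: (arc_cont Ag).
  by apply: cvgD; [exact: cvg_cst|apply: cvgMl; exact: cvg_id].
- move=> e e' t t' t01 t'01 /(arc_disj Ag (itvo _ _ t01) (itv _ _ t'01))[ee'].
  by subst e' => /inj.
- move=> e /(arc_inj Ag) H; have := H _ _; rewrite !itv ?lexx ?ler01// => /(_ isT isT)/inj.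
  by move=> /eqP; rewrite eq_sym oner_eq0.
Qed.

(** The new start is an interior point of the original arc, so it lies on no other arc. *)
Lemma trimmed_free_end e : 0 < l e -> free_end (g := trimmed_arc) e.
Proof.
move=> l0 e' t t01; rewrite /trimmed_arc mul0r addr0 => /esym.
have /andP[l'0 l'1] := l01 e'.
have le01 : 0 < l e < 1 by rewrite l0; case/andP: (l01 e).
have t'01 : 0 <= l e' + t * (1 - l e') <= 1.
  case/andP: t01 => t0 t1; have : t * (1 - l e') <= 1 - l e'.
    by rewrite ler_piMl// subr_ge0 ltW.
  have : 0 <= t * (1 - l e') by rewrite mulr_ge0// subr_ge0 ltW.
  by move=> ? ?; apply/andP; split; lra.
by move=> /(arc_disj Ag le01 t'01)[].
Qed.

End trimmed_arcs.

Section exhausting_subgraph.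
Context {R : realType} {G : metricType R} {E : finType} {g : E -> R -> G}.
Context {f : G -> G} {D : nat -> set G}.
Context (Gg : arcs setT g) (fD : exhaustion f D) (e0 : E).
Context (cut_start : forall e, cut D (g e) -> cut_at_start D (g e)).

Lemma exhausting_subgraph : exists n (l : E -> R),
  [/\ forall e, 0 <= l e < 1, forall e, cut D (g e) -> 0 < l e &
    D n = \bigcup_(e in [set: E]) trimmed_arc (g := g) l e @` `[0, 1]].
Proof.
have [n Hn] : exists n, forall e, (~ cut D (g e) -> forall t, 0 <= t <= 1 -> D n (g e t)) /\
    (cut D (g e) -> forall t, 1 / 2 <= t <= 1 -> D n (g e t)).
  apply: (finite_uniform_nat (P := fun e n =>
    (~ cut D (g e) -> forall t, 0 <= t <= 1 -> D n (g e t)) /\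
    (cut D (g e) -> forall t, 1 / 2 <= t <= 1 -> D n (g e t)))).
    move=> e m n mn [H1 H2]; split=> [nc t t01|c t t01]; apply: (exh_le fD mn).
      exact: H1.
    exact: H2.
  move=> e; have [ce|nce] := pselect (cut D (g e)).
    have [n Hn] := cut_away0 (cut_start ce) (divr_gt0 ltr01 (ltr0Sn R 1)).
    by exists n.
  move: (nce) => /existsNP[n Hn]; exists n; split => // _ t t01.
  by apply: contrapT => nD; apply: Hn; exists t.
have /choice[l lP] : forall e, exists l, [/\ 0 <= l < 1,
    forall t, l <= t <= 1 -> D n (g e t) &
    (~ cut D (g e) /\ l = 0) \/ (cut D (g e) /\ 0 < l /\
      forall t, 0 < t < l -> ~ D n (g e t))].
  move=> e; have [Hn1 Hn2] := Hn e.
  have [ce|nce] := pselect (cut D (g e)); last first.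
    by exists 0; rewrite lexx ltr01; split => //; [exact: Hn1|left].
  have [c c0 Hc] := cut_near0 (cut_start ce) n.
  (* The search for the first parameter in [D n] begins at [c / 2], because the start [g e 0] may
     itself belong to [D n]. *)
  pose K := `[c / 2, 1] `&` g e @^-1` D n.
  have c12 : c <= 1 / 2.
    by rewrite leNgt; apply/negP => ch; apply: (Hc (1 / 2)); [lra|apply: Hn2 => //; lra].
  have cK : compact K.
    apply: compact_closedI; first exact: segment_compact.
    apply: preimage_closed; last exact: (exh_closed fD).
    by move=> x _; exact: (arc_cont Gg).
  have K0 : K !=set0.
    by exists 1; split; [rewrite /= in_itv/=; lra|apply: Hn2 => //; lra].
  have cid : {within K, continuous (fun x : R => x)}.
    by apply: continuous_subspaceT => x; exact: cvg_id.
  have [l /set_mem[+ Dl] lmin] := compact_EVT_min K0 cK cid.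
  rewrite /= in_itv/= => /andP[cl l1].
  have below t : 0 < t < l -> ~ D n (g e t).
    move=> /andP[t0 tl] Dt; have [tc|ct] := ltP t c; first by apply: (Hc t); rewrite ?t0.
    have := lmin t; rewrite leNgt tl => /(_ _)/negP; apply => //.
    by apply: mem_set; split => //=; rewrite in_itv/=; apply/andP; split; lra.
  have l12 : l <= 1 / 2.
    apply: lmin; apply: mem_set; split; first by rewrite /= in_itv/=; lra.
    by apply: Hn2 => //; lra.
  exists l; split; [lra| |by right; split => //; split => //; lra].
  move=> t /andP[lt_ t1]; apply: contrapT => nDt.
  have [tl|tl] := eqVneq t l; first by apply: nDt; rewrite tl.
  have [t1'|t1'] := eqVneq t 1; first by apply: nDt; rewrite t1'; apply: Hn2 => //; lra.
  have {}lt_ : l < t by rewrite lt_neqAle eq_sym tl.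
  have {}t1 : t < 1 by rewrite lt_neqAle t1'.
  have cl' : c / 2 < l.
    by rewrite ltNge; apply/negP => lc; apply: (Hc l) => //; apply/andP; split; lra.
  have D1 : D n (g e 1) by apply: Hn2 => //; lra.
  (* A missing point beyond [l], together with the one at [c / 2], would trap [D n] in a subarc that
     does not contain [g e 1]. *)
  have sub : D n `<=` g e @` `]c / 2, t[.
    apply: (@arc_separation _ _ _ _ _ Gg e (c / 2) t l (D n)) => //.
    - exact: (exh_connected fD).
    - lra.
    - exact: ltW.
    - by rewrite cl'.
    - by apply: Hc; apply/andP; split; lra.
  have [v /= + /(arc_inj Gg) v1] := sub _ D1.
  rewrite in_itv/= => /andP[cv vt]; have : v = 1 by apply: v1; apply/andP; split; lra.
  lra.
exists n, l; have l01 e : 0 <= l e < 1 by have [] := lP e.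
split=> //; first by move=> e ce; have [_ _ [[]|[_ []]]] := lP e.
have inI e t : 0 <= t <= 1 -> l e <= t ->
    (\bigcup_(e in [set: E]) trimmed_arc (g := g) l e @` `[0, 1]) (g e t).
  move=> /andP[t0 t1] lt_; have /andP[l0 l1] := l01 e; exists e => //.
  exists ((t - l e) / (1 - l e)).
    rewrite /= in_itv/= divr_ge0 ?subr_ge0 ?(ltW l1)//=.
    by rewrite ler_pdivrMr ?subr_gt0// mul1r lerB.
  by rewrite /trimmed_arc divfK ?subrKC// gt_eqF// subr_gt0.
have Tg := trimmed_arcs Gg l01.
(* Beyond the trimmed arcs, [D n] can only contain some of the points [g e 0]; connectedness
   excludes such a remainder. *)
apply: connected_cofinite.
- exact: metric_hausdorff.
- exact: (exh_connected fD).
- apply: closed_bigcup; first exact: finite_finset.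
  by move=> e _; exact: (arc_closed Tg).
- move=> x /(arc_coverP Tg)[e [t [/andP[t0 t1] ->]]].
  have [/andP[l0 l1] Dl _] := lP e; apply: Dl.
  have : t * (1 - l e) <= 1 - l e by rewrite ler_piMl// subr_ge0 ltW.
  have : 0 <= t * (1 - l e) by rewrite mulr_ge0// subr_ge0 ltW.
  by move=> ? ?; apply/andP; split; lra.
- exists (g e0 1); apply: inI; first by rewrite lexx ler01.
  by have /andP[_ /ltW] := l01 e0.
- apply: (@sub_finite_set _ _ [set g e 0 | e in [set: E]]); last first.
    by apply: finite_image; exact: finite_finset.
  move=> x [Dx nx]; have [e [t [t01 xt]]] := arc_coverP Gg (I : setT x).
  exists e => //; case/andP: (t01) => t0 t1; rewrite xt in Dx nx *.
  have [tl|lt_] := ltP t (l e); last by case: nx; exact: inI.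
  have [->//|tn0] := eqVneq t 0.
  have [_ _ [[_ le0]|[_ [_ below]]]] := lP e; first by move: tl; rewrite le0 ltNge t0.
  by case: (below t) => //; rewrite tl lt_neqAle t0 eq_sym tn0.
Qed.

End exhausting_subgraph.

Theorem corollary7p4 (R : realType) (G : metricType R)
    (graphG : is_graph [set: G]) :
  ((1 / (Lambda G)%:R * ln 3)%:E <=
   ereal_inf [set topological_entropy f | f in @pure_mixing_maps G])%E.
Proof.
have [E0 [g0 [Gg0 _ E2]]] := is_graph_arcs graphG.
have cG : compact [set: G] by case: graphG.
apply: le_ereal_inf_tmp => _ [f [cf mf nf] <-].
have fsurj := mixing_surjective cG cf mf.
have [D fD] := exhaustion_exists Gg0 E2 cf mf nf.
have [E [g [Gg cut_start]]] := arcs_cut_at_start Gg0 E2 fD.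
have [s [k [/andP[k0 kends] side preimage]]] := end_cycle Gg fD cf fsurj cut_start.
apply: le_trans (end_entropy Gg cf mf k0 side preimage).
rewrite lee_fin mul1r mulrC.
have ln3 : 0 <= ln 3 :> R by rewrite ln_ge0// ler1n.
(* For the default value 0 the inverse is 0 and the bound is trivial. *)
have [L0|/eqP L0] := eqVneq (Lambda G) 0%N.
  by rewrite L0 invr0 mulr0 divr_ge0.
have L_gt0 : (0 < Lambda G)%N by rewrite lt0n; apply/eqP.
rewrite ler_wpM2l// lef_pV2 ?posrE ?ltr0n//.
rewrite ler_nat (leq_trans kends)//.
have [n [l [l01 lcut DE]]] := exhausting_subgraph Gg fD s cut_start.
have Dg := trimmed_arcs Gg l01; rewrite -DE in Dg.
have cD := exh_connected fD n.
have gD : is_graph (D n).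
  apply: (arcs_is_graph Dg s) => //.
  by apply: subclosed_compact cG _ => //; exact: (exh_closed fD).
(* The trimmed starts of the ends are free ends of [D n], so their number is even strictly below the
   disconnecting number of this subgraph. *)
apply: leq_trans (disconnecting_number_Lambda gD L0); apply: ltnW.
apply: (free_ends_disconnecting_number Dg cD) => e; rewrite inE => /asboolP ce.
by apply: (trimmed_free_end Gg l01); exact: lcut.
Qed.
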